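(* Opt-ISR admits a fixed-parameter algorithm when parameterized by $s + d$, where $s$ is the solution size and $d$ is the degeneracy of an input graph.
   Context: For an integer $l \ge 0$, two independent sets $I_p, I_q$ of a graph $G$ with $|I_p|, |I_q| \ge l$ are reachable under the $\mathsf{TAR}(l)$ rule if there is a sequence $\langle I_1, \ldots, I_\ell \rangle$ of independent sets of $G$ with $I_1 = I_p$, $I_\ell = I_q$, $|I_i| \ge l$ for all $i$, and $|I_i \triangle I_{i+1}| = 1$ for all $i$. Opt-ISR parameterized by solution size $s$: given a graph $G$, an integer $l \ge 0$, an independent set $I_{\mathrm{ini}}$ of $G$ with $|I_{\mathrm{ini}}| \ge l$, and an integer $s$, decide whether $G$ has an independent set $I$ with $|I| \ge s$ reachable from $I_{\mathrm{ini}}$ under the $\mathsf{TAR}(l)$ rule. The degeneracy of $G$ is the minimum $d$ such that every induced subgraph of $G$ has a vertex of degree at most $d$. *)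

(* Defs.v *)
From mathcomp Require Import all_boot.

Set Implicit Arguments.
Unset Strict Implicit.
Unset Printing Implicit Defensive.

(** * Computation model

    A first-order functional language on binary trees, in the style of the
    languages F and WHILE of N. D. Jones (Computability and Complexity from a
    Programming Perspective), with unit cost per evaluated construct.  Data can
    only be built and destructed one node at a time, and for this cost measure
    the language and (multi-tape) Turing machines simulate each other with
    polynomial overhead, so that "time f(k) * |x|^O(1)" means the same thing in
    both models. *)

Inductive data : Type :=
| Leaf
| Node of data & data.

Fixpoint dsize (x : data) : nat :=
  if x is Node a b then (dsize a + dsize b).+1 else 1.

(** Variables are de Bruijn indices.  [ELet] binds one variable; the third
    argument of [ECase] is under two binders, index 0 being the left subtree and
    index 1 the right one. *)
Inductive exp : Type :=
| EVar of nat
| ELeaf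
| ENode of exp & exp
| ECase of exp & exp & exp
| ELet of exp & exp
| ECall of nat & exp.

(** The list of the bodies of (mutually recursive) unary functions; [ECall i]
    calls the [i]-th one, and function 0 is the entry point.  Unbound variables
    and undefined functions yield [Leaf]. *)
Definition program := seq exp.

(** [eval P env e v t]: in environment [env], [e] evaluates to [v] in time
    [t]. *)
Inductive eval (P : program) : seq data -> exp -> data -> nat -> Prop :=
| eval_var env i :
    eval P env (EVar i) (nth Leaf env i) 1
| eval_leaf env :
    eval P env ELeaf Leaf 1
| eval_node env e1 e2 v1 v2 t1 t2 :
    eval P env e1 v1 t1 -> eval P env e2 v2 t2 ->
    eval P env (ENode e1 e2) (Node v1 v2) (t1 + t2).+1
| eval_case_leaf env e e1 e2 v t t1 :
    eval P env e Leaf t -> eval P env e1 v t1 ->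
    eval P env (ECase e e1 e2) v (t + t1).+1
| eval_case_node env e e1 e2 a b v t t2 :
    eval P env e (Node a b) t -> eval P [:: a, b & env] e2 v t2 ->
    eval P env (ECase e e1 e2) v (t + t2).+1
| eval_let env e1 e2 v1 v t1 t2 :
    eval P env e1 v1 t1 -> eval P (v1 :: env) e2 v t2 ->
    eval P env (ELet e1 e2) v (t1 + t2).+1
| eval_call env i e a v t1 t2 :
    eval P env e a t1 -> eval P [:: a] (nth ELeaf P i) v t2 ->
    eval P env (ECall i e) v (t1 + t2).+1.

Definition runs (P : program) (input output : data) (t : nat) : Prop :=
  eval P [:: input] (nth ELeaf P 0) output t.

(** Evaluation is deterministic, in its result and in its cost: existential
    statements about [runs] therefore speak about the run of the program. *)
Lemma eval_det P env e v t v' t' :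
  eval P env e v t -> eval P env e v' t' -> v = v' /\ t = t'.
Proof.
move=> ev; elim: ev v' t' => {env e v t};
  intros; match goal with H : eval _ _ _ _ _ |- _ =>
    inversion H; subst; clear H end => //;
  repeat match goal with
  | IH : forall v' t', eval P ?env ?e v' t' -> _,
    H : eval P ?env ?e _ _ |- _ =>
      let E := fresh in
      have [E ?] := IH _ _ H; clear H; try discriminate E;
      try (injection E; clear E; intros); subst
  end => //.
Qed.

Definition enc_bool (b : bool) : data := if b then Node Leaf Leaf else Leaf.

Definition enc_nat (n : nat) : data := iter n (Node Leaf) Leaf.

Definition enc_seq (s : seq data) : data := foldr Node Leaf s.

Definition computable (f : nat -> nat) : Prop :=
  exists P : program, forall n, exists t, runs P (enc_nat n) (enc_nat (f n)) t.

(** The problem "[yes x]?" on instances [x : X], presented to algorithms as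
    [enc x], is decided in time [f (kappa x) * |enc x| ^ c] by a single program,
    for some computable [f] and some constant [c]. *)
Definition fixed_parameter_tractable (X : Type) (enc : X -> data)
    (yes : X -> Prop) (kappa : X -> nat) : Prop :=
  exists (P : program) (f : nat -> nat) (c : nat),
    computable f /\
    forall x : X, exists (b : bool) (t : nat),
      [/\ runs P (enc x) (enc_bool b) t,
          t <= f (kappa x) * dsize (enc x) ^ c
        & yes x <-> b].

(** * Graphs and token addition/removal *)

Record graph : Type := Graph {
  nverts : nat;
  adj : rel 'I_nverts;
  adj_sym : symmetric adj;
  adj_irr : irreflexive adj
}.

Definition independent (G : graph) (I : {set 'I_(nverts G)}) : bool :=
  [forall x in I, forall y in I, ~~ adj x y].

Definition symdiff (T : finType) (A B : {set T}) : {set T} :=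
  (A :\: B) :|: (B :\: A).

Definition TAR_reachable (G : graph) (l : nat) (I J : {set 'I_(nverts G)}) :
    Prop :=
  exists p : seq {set 'I_(nverts G)},
    [/\ all (fun K => independent K && (l <= #|K|)) (I :: p),
        path (fun A B => #|symdiff A B| == 1) I p
      & last I p = J].

(** An induced subgraph is given by its nonempty vertex set [S]. *)
Definition degenerate (G : graph) (d : nat) : bool :=
  [forall S : {set 'I_(nverts G)}, (S != set0) ==>
     [exists v in S, #|[set u in S | adj v u]| <= d]].

Lemma degenerate_ex (G : graph) : exists d, degenerate G d.
Proof.
exists #|'I_(nverts G)|; apply/forallP => S; apply/implyP => /set0Pn [v vS].
by apply/existsP; exists v; rewrite vS max_card.
Qed.

Definition degeneracy (G : graph) : nat := ex_minn (degenerate_ex G).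

(** * The problem Opt-ISR *)

Record optISR_instance : Type := OptISR {
  inst_graph : graph;
  inst_thr : nat;
  inst_ini : {set 'I_(nverts inst_graph)};
  inst_size : nat;
  inst_ini_indep : independent inst_ini;
  inst_ini_thr : inst_thr <= #|inst_ini|
}.

Definition optISR (x : optISR_instance) : Prop :=
  exists J : {set 'I_(nverts (inst_graph x))},
    [/\ independent J, inst_size x <= #|J|
      & TAR_reachable (inst_thr x) (inst_ini x) J].

Definition enc_set (n : nat) (I : {set 'I_n}) : data :=
  enc_seq [seq enc_bool (v \in I) | v <- enum 'I_n].

Definition enc_graph (G : graph) : data :=
  enc_seq [seq enc_seq [seq enc_bool (adj u v) | v <- enum 'I_(nverts G)]
          | u <- enum 'I_(nverts G)].

(** The graph is given by its adjacency matrix, the initial set by its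
    characteristic vector.  Writing [l] and [s] in unary rather than in binary is
    immaterial for fixed-parameter tractability here: [l] is at most the order
    of the graph, and [s] is part of the parameter. *)
Definition enc_optISR (x : optISR_instance) : data :=
  enc_seq [:: enc_graph (inst_graph x); enc_nat (inst_thr x);
              enc_set (inst_ini x); enc_nat (inst_size x)].

Definition optISR_param (x : optISR_instance) : nat :=
  inst_size x + degeneracy (inst_graph x).

(* Main.v *)
Require Import Defs.
From mathcomp Require Import all_boot zify.

Set Implicit Arguments.
Unset Strict Implicit.
Unset Printing Implicit Defensive.

(* Let [d] be the degeneracy.  Removing a vertex of minimum degree again and
   again orients the edges so that all out-degrees are at most [d].  Suppose that
   [s (d + 2)] vertices have out-neighbourhoods that contain a common core and
   are pairwise disjoint outside of it.  Then any other vertex [u] whose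
   out-neighbourhood contains the core can be deleted: fewer than [s] tokens
   block fewer than [s (d + 2)] of these vertices, so that one of them can always
   stand in for [u].  The search that proves the sunflower lemma, run for
   [d + 1] levels, finds a set whose size is bounded in terms of [s] and [d] and
   outside of which every vertex can be deleted; the sequences of its independent
   sets are then enumerated.

   The algorithm is written in a total language whose only recursion is the fold
   over a list: its running time is polynomial in the length of the longest list
   that is folded over, so that only such lengths need to be bounded. *)

(** * A language of folds *)

(** The delicate case of a deletion is a substitute that gets blocked: a token that may stand next
    to [u] need not be allowed next to the member of the sunflower that stands in for [u]. The
    substitute is then exchanged for another one, and for a moment both carry a token. A substitute
    may therefore have to avoid a token that is itself adjacent to [u], and the condition on
    blocking tokens is tailored to this.

    A token in the common core would block all members at once; it does not occur, because it would
    be a neighbour of [u]. No deletion spoils another one, as all substitutes lie in the set that is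
    kept.

    The algorithm never computes the degeneracy: it works with the largest out-degree of the
    orientation it has found, which is at most the degeneracy.

    The exponent of the input size must not depend on the parameter. It comes from one fixed term;
    the parameter merely lengthens the lists that are folded over. *)

Inductive tm : Type :=
| TVar of nat
| TLeaf
| TNode of tm & tm
| TCase of tm & tm & tm
| TFold of tm & tm & tm.

Coercion TVar : nat >-> tm.

Fixpoint spine (x : data) : nat := if x is Node _ b then (spine b).+1 else 0.

Fixpoint dfold (b : data) (f : data -> data -> data) (x : data) : data :=
  if x is Node h t then f h (dfold b f t) else b.

Fixpoint den (t : tm) (env : seq data) : data :=
  match t with
  | TVar i => nth Leaf env i
  | TLeaf => Leaf
  | TNode a b => Node (den a env) (den b env)
  | TCase e e1 e2 =>
      if den e env is Node a b then den e2 [:: a, b & env] else den e1 env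
  | TFold l b s =>
      dfold (den b env) (fun h r => den s [:: h, r & env]) (den l env)
  end.

Fixpoint fold_all (b : data) (f : data -> data -> data)
    (Q : data -> data -> Prop) (x : data) : Prop :=
  if x is Node h t then fold_all b f Q t /\ Q h (dfold b f t) else True.

(** The bound is required along the actual run only: for the branch that is taken, and for the loop
    body on the accumulators that occur. It concerns lengths of lists folded over, not sizes of
    values. *)
Fixpoint folds_le (S : nat) (t : tm) (env : seq data) : Prop :=
  match t with
  | TVar _ | TLeaf => True
  | TNode a b => folds_le S a env /\ folds_le S b env
  | TCase e e1 e2 => folds_le S e env /\
      if den e env is Node a b then folds_le S e2 [:: a, b & env] else folds_le S e1 env
  | TFold l b s =>
      [/\ folds_le S l env, folds_le S b env, spine (den l env) <= S &
       fold_all (den b env) (fun h r => den s [:: h, r & env])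
         (fun h r => folds_le S s [:: h, r & env]) (den l env)]
  end.

Fixpoint nfolds (t : tm) : nat :=
  match t with
  | TVar _ | TLeaf => 0
  | TNode a b => nfolds a + nfolds b
  | TCase e e1 e2 => nfolds e + (nfolds e1 + nfolds e2)
  | TFold l b s => (nfolds l + (nfolds b + nfolds s)).+1
  end.

(** * Compilation into the unit-cost language *)

Fixpoint lookup_exp (i : nat) (e : exp) : exp :=
  if i is i'.+1 then lookup_exp i' (ECase e ELeaf (EVar 1))
  else ECase e ELeaf (EVar 0).

(* The whole environment of a term is held, as a list, in variable 0 of its
   compiled expression; the bodies of its folds are the functions of indices
   [k], [k + 1], ... *)
Fixpoint compile (k : nat) (t : tm) : exp :=
  match t with
  | TVar i => lookup_exp i (EVar 0)
  | TLeaf => ELeaf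
  | TNode a b => ENode (compile k a) (compile (k + nfolds a) b)
  | TCase e e1 e2 =>
      ECase (compile k e) (compile (k + nfolds e) e1)
        (ELet (ENode (EVar 0) (ENode (EVar 1) (EVar 2)))
           (compile (k + nfolds e + nfolds e1) e2))
  | TFold l b s => ECall k (ENode (EVar 0) (compile k.+1 l))
  end.

(** Functions are unary, so a loop receives the pair of its environment and the list; the recursive
    call passes the tail with the same environment. *)
Definition fold_body (k : nat) (b s : exp) : exp :=
  ECase (EVar 0) ELeaf
    (ECase (EVar 1) (ELet (EVar 0) b)
       (ELet (ENode (EVar 0)
                (ENode (ECall k (ENode (EVar 2) (EVar 1))) (EVar 2))) s)).

Fixpoint bodies (k : nat) (t : tm) : program :=
  match t with
  | TVar _ | TLeaf => [::]
  | TNode a b => bodies k a ++ bodies (k + nfolds a) b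
  | TCase e e1 e2 =>
      bodies k e ++ bodies (k + nfolds e) e1
        ++ bodies (k + nfolds e + nfolds e1) e2
  | TFold l b s =>
      let kb := k.+1 + nfolds l in
      let ks := kb + nfolds b in
      fold_body k (compile kb b) (compile ks s)
        :: bodies k.+1 l ++ bodies kb b ++ bodies ks s
  end.

Lemma size_bodies k t : size (bodies k t) = nfolds t.
Proof.
elim: t k => //= [a IHa b IHb|e IHe e1 IH1 e2 IH2|l IHl b IHb s IHs] k;
  by rewrite !size_cat ?IHa ?IHb ?IHe ?IH1 ?IH2 ?IHl ?IHs.
Qed.

Definition loaded (P : program) (k : nat) (B : program) : Prop :=
  forall i, i < size B -> nth ELeaf P (k + i) = nth ELeaf B i.

Lemma loaded_cat P k B1 B2 :
  loaded P k (B1 ++ B2) <-> loaded P k B1 /\ loaded P (k + size B1) B2.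
Proof.
split=> [H|[H1 H2] i].
  split=> i lti; first by rewrite H ?nth_cat ?lti // size_cat ltn_addr.
  rewrite -addnA H ?size_cat ?ltn_add2l // nth_cat ltnNge leq_addr /=.
  by rewrite addKn.
rewrite size_cat nth_cat => lti; case: ltnP => [/H1//|le1].
by rewrite -H2 ?ltn_subLR // -addnA subnKC.
Qed.

Lemma loaded_cons P k e B :
  loaded P k (e :: B) <-> nth ELeaf P k = e /\ loaded P k.+1 B.
Proof.
split=> [H|[<- H] [|i]] /=; last 2 first.
- by rewrite addn0.
- by rewrite addnS -addSn; apply: H.
split; first by have := H 0 isT; rewrite addn0.
by move=> i lti; have := H i.+1 lti; rewrite addnS -addSn.
Qed.

Fixpoint time_bound (S : nat) (t : tm) : nat :=
  match t with
  | TVar i => 2 * i + 4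
  | TLeaf => 1
  | TNode a b => (time_bound S a + time_bound S b).+1
  | TCase e e1 e2 =>
      time_bound S e + time_bound S e1 + time_bound S e2 + 8
  | TFold l b s =>
      time_bound S l + time_bound S b + S * (time_bound S s + 20) + 20
  end.

Lemma eval_le P env e v t t' :
  eval P env e v t -> t = t' -> eval P env e v t'.
Proof. by move=> ? <-. Qed.

Lemma eval_lookup P env x e i t :
  eval P env e (enc_seq x) t ->
  eval P env (lookup_exp i e) (nth Leaf x i) (t + 2 * i + 2).
Proof.
elim: i x e t => [|i IH] x e t ev /=.
  case: x ev => [|a x] ev; (apply: eval_le;
    [first [exact: eval_case_leaf ev (eval_leaf _ _)
     | exact: eval_case_node ev (eval_var _ _ 0)] | lia]).
have {}ev: eval P env (ECase e ELeaf (EVar 1)) (enc_seq (behead x)) (t + 1).+1.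
  case: x ev => [|a x] ev; first exact: eval_case_leaf ev (eval_leaf _ _).
  exact: eval_case_node ev (eval_var _ _ 1).
by apply: eval_le; [rewrite -nth_behead; exact: IH ev | lia].
Qed.

(** The cost [n] is chosen before [rest]: of its context, compiled code reads only variable 0,
    whatever the enclosing constructs have left behind it. *)
Lemma compile_correct P S t k env :
  loaded P k (bodies k t) -> folds_le S t env ->
  exists2 n, n <= time_bound S t &
    forall rest, eval P (enc_seq env :: rest) (compile k t) (den t env) n.
Proof.
elim: t k env => [i||a IHa b IHb|e IHe e1 IH1 e2 IH2|l IHl b IHb s IHs] k env.
- move=> _ _; exists (1 + 2 * i + 2); first by rewrite /=; lia.
  by move=> rest; apply: eval_lookup; apply: (eval_var _ (_ :: _) 0).
- by move=> _ _; exists 1 => // rest; apply: eval_leaf.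
- rewrite /= loaded_cat size_bodies => -[la lb] [oa ob].
  have [n1 le1 ev1] := IHa _ _ la oa.
  have [n2 le2 ev2] := IHb _ _ lb ob.
  exists (n1 + n2).+1; first lia.
  by move=> rest; apply: eval_node.
- rewrite /= !loaded_cat !size_bodies => -[le [l1 l2]] [oe].
  have [n lenn ev] := IHe _ _ le oe.
  case Ee: (den e env) ev => [|x y] ev o.
    have [n1 len1 ev1] := IH1 _ _ l1 o.
    exists (n + n1).+1; first lia.
    by move=> rest; apply: eval_case_leaf.
  have [n2 len2 ev2] := IH2 _ _ l2 o.
  exists (n + ((1 + (1 + 1).+1).+1 + n2).+1).+1; first lia.
  move=> rest; apply: eval_case_node => //; apply: eval_let; last exact: ev2.
  apply: eval_node; first exact: (eval_var _ _ 0).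
  by apply: eval_node; [exact: (eval_var _ _ 1) | exact: (eval_var _ _ 2)].
rewrite /= loaded_cons !loaded_cat !size_bodies => -[Pk [ll [lb ls]]].
move=> [ol ob leS].
have [n lenn evl] := IHl _ _ ll ol.
have [nb lenb evb] := IHb _ _ lb ob.
set d := den l env in evl leS *; set db := den b env in evb *.
set f := fun _ _ => _; move=> okf.
(* The call starts in a fresh environment that holds only the pair, so the loop is analysed by
   induction on the list with [env] fixed. *)
suff [m lem evm]: exists2 m, m <= nb + spine d * (time_bound S s + 20) + 10 &
  eval P [:: Node (enc_seq env) d] (nth ELeaf P k) (dfold db f d) m.
  exists ((1 + n).+1 + m).+1.
    have: spine d * (time_bound S s + 20) <= S * (time_bound S s + 20).
      by rewrite leq_mul2r leS orbT.
    by lia.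
  move=> rest; apply: eval_call evm.
  by apply: eval_node (evl _); apply: (eval_var _ (_ :: _) 0).
rewrite Pk; elim: d okf {evl leS} => [_|h _ r IHr] /=.
  exists (1 + (1 + (1 + nb).+1).+1).+1; first lia.
  apply: eval_case_node; first exact: (eval_var _ _ 0).
  apply: eval_case_leaf; first exact: (eval_var _ _ 1).
  by apply: eval_let; [exact: (eval_var _ _ 0) | exact: evb].
case=> /IHr [m lem evm] os.
have [ns lens evs] := IHs _ _ ls os.
exists (1 + (1 + ((1 + (((1 + 1).+1 + m).+1 + 1).+1).+1 + ns).+1).+1).+1; first lia.
apply: eval_case_node; first exact: (eval_var _ _ 0).
apply: eval_case_node; first exact: (eval_var _ _ 1).
apply: eval_let; last exact: evs.
apply: eval_node; first exact: (eval_var _ _ 0).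
apply: eval_node; last exact: (eval_var _ _ 2).
apply: eval_call; last by rewrite Pk; exact: evm.
by apply: eval_node; [exact: (eval_var _ _ 2) | exact: (eval_var _ _ 1)].
Qed.

Definition compiled (t : tm) : program :=
  ELet (ENode (EVar 0) ELeaf) (compile 1 t) :: bodies 1 t.

Lemma compiled_correct S t x :
  folds_le S t [:: x] ->
  exists2 n, n <= time_bound S t + 4 &
    runs (compiled t) x (den t [:: x]) n.
Proof.
move=> okt; have ld: loaded (compiled t) 1 (bodies 1 t) by move=> i.
have [n len ev] := compile_correct ld okt.
exists ((1 + 1).+1 + n).+1; first lia.
apply: eval_let; last exact: ev.
by apply: eval_node; [exact: (eval_var _ _ 0) | exact: eval_leaf].
Qed.

(** One [c] serves as coefficient and as exponent, so that the bounds for subterms are merged by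
    adding up their constants; the base [S.+1] keeps the powers positive and monotone in [c]. *)
Lemma time_bound_poly t :
  exists c, forall S, time_bound S t <= c * S.+1 ^ c.
Proof.
have up S c c' : c <= c' -> c * S.+1 ^ c <= c * S.+1 ^ c'.
  by move=> lec; rewrite leq_mul2l leq_pexp2l ?orbT.
have pos S c : 0 < S.+1 ^ c by rewrite expn_gt0.
elim: t => [i||a [ca Ha] b [cb Hb]|e [c0 H0] e1 [c1 H1] e2 [c2 H2]
           |l [c0 H0] b [c1 H1] s [c2 H2]].
- by exists (2 * i + 4) => S; rewrite leq_pmulr.
- by exists 1 => S; rewrite mul1n.
- exists (ca + cb + 1) => S /=; set c := (X in _ ^ X).
  have := Ha S; have := Hb S; have := up S ca c; have := up S cb c.
  by have := pos S c; move: (S.+1 ^ c) => X; rewrite /c; lia.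
- exists (c0 + c1 + c2 + 8) => S /=; set c := (X in _ ^ X).
  have := H0 S; have := H1 S; have := H2 S.
  have := up S c0 c; have := up S c1 c; have := up S c2 c.
  by have := pos S c; move: (S.+1 ^ c) => X; rewrite /c; lia.
(* The [40] pays for the overheads of 20 per iteration and 20 per loop, and makes the exponent
   exceed [c2], since the loop contributes one more factor [S.+1]. *)
exists (c0 + c1 + c2 + 40) => S /=; set c := (X in _ ^ X).
have loop : S * (time_bound S s + 20) <= c2 * S.+1 ^ c + 20 * S.+1 ^ c.
  apply: (@leq_trans (S.+1 * (c2 * S.+1 ^ c2 + 20 * S.+1 ^ c2))).
    by rewrite leq_mul // leq_add // leq_pmulr.
  rewrite -!mulnDl mulnCA leq_mul2l -expnS leq_pexp2l ?orbT //.
  by rewrite /c; lia.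
have := H0 S; have := H1 S; have := up S c0 c; have := up S c1 c.
by have := pos S c; move: loop; move: (S.+1 ^ c) => X; rewrite /c; lia.
Qed.

(** * Deleting replaceable vertices *)

Section Replacement.

Variables (G : graph) (l s : nat).
Notation V := 'I_(nverts G).

Definition valid (I : {set V}) : bool := independent I && (l <= #|I|).

(** A boolean relation on a finite type, so that reachability inside [W] is [connect] and walks can
    be shortened. *)
Definition step_in (W A B : {set V}) : bool :=
  [&& A \subset W, B \subset W, valid A, valid B & #|symdiff A B| == 1].

Lemma independentP (I : {set V}) :
  reflect {in I &, forall x y, ~~ adj x y} (independent I).
Proof.
apply: (iffP forall_inP) => [H x y xI yI|H x xI].
  by move/forall_inP: (H x xI); apply.
by apply/forall_inP => y; apply: H.
Qed.

Lemma independentS (A B : {set V}) : A \subset B -> independent B -> independent A.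
Proof.
by move=> /subsetP sAB /independentP iB; apply/independentP => x y /sAB ? /sAB;
  apply: iB.
Qed.

Lemma independentU1 v (A : {set V}) :
  independent (v |: A) = independent A && [forall x in A, ~~ adj v x].
Proof.
apply/idP/andP => [iA|[/independentP iA /forall_inP vA]].
  split; first exact: independentS (subsetUr _ _) iA.
  by apply/forall_inP => x xA; move/independentP: iA; apply;
    rewrite !inE ?xA ?eqxx ?orbT.
apply/independentP => x y /setU1P [->|xA] /setU1P [->|yA].
- by rewrite adj_irr.
- exact: vA.
- by rewrite adj_sym vA.
- exact: iA.
Qed.

Lemma symdiffC (A B : {set V}) : symdiff A B = symdiff B A.
Proof. exact: setUC. Qed.

Lemma symdiffU1 (A : {set V}) v : v \notin A -> #|symdiff A (v |: A)| == 1.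
Proof.
move=> vA; rewrite (_ : symdiff _ _ = [set v]) ?cards1 //.
apply/setP => x; rewrite !inE; case: eqP => [->|_]; first by rewrite (negbTE vA).
by case: (x \in A).
Qed.

Lemma symdiff1P (A B : {set V}) : #|symdiff A B| == 1 ->
  (exists2 v, v \notin A & B = v |: A) \/ (exists2 v, v \notin B & A = v |: B).
Proof.
case/cards1P => v /setP E.
have E' x : (x \in A) (+) (x \in B) = (x == v).
  by have := E x; rewrite !inE => <-; case: (x \in A); case: (x \in B).
have := E' v; rewrite eqxx; case: (boolP (v \in A)) => vA /= vB.
  right; exists v => //; apply/setP => x; rewrite !inE.
  by have := E' x; case: eqP => [->|_]; [rewrite vA | case: (x \in A);
    case: (x \in B)].
left; exists v => //; apply/setP => x; rewrite !inE.
by have := E' x; case: eqP => [->|_]; [rewrite vB | case: (x \in A);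
  case: (x \in B)].
Qed.

Lemma step_in_sym W : symmetric (step_in W).
Proof.
by move=> A B; rewrite /step_in symdiffC; case: (A \subset W); case: (B \subset W);
  case: (valid A); case: (valid B).
Qed.

Lemma step_inU1 (W A : {set V}) v : v \notin A -> v |: A \subset W ->
  independent (v |: A) -> l <= #|A| -> step_in W A (v |: A).
Proof.
move=> vA sW iA lA; rewrite /step_in sW symdiffU1 // /valid iA.
rewrite (independentS (subsetUr [set v] A) iA) (subset_trans (subsetUr _ _) sW) lA.
by rewrite cardsU1 vA (leq_trans lA) ?leq_addl.
Qed.

(** [T] stands for tokens compatible with [u], except that a substitute in [F] may happen to be
    adjacent to [u]. [F] lies in [K] in order to outlive all deletions outside [K]. *)
Definition replaceable (K : {set V}) (u : V) : Prop :=
  exists F : {set V}, [/\ F \subset K, u \notin F &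
    forall T : {set V}, #|T| < s -> (forall t, t \in T -> adj t u -> t \in F) ->
      exists v, [/\ v \in F, v \notin T & [forall t in T, ~~ adj v t]]].

Definition improvable (I W : {set V}) : Prop :=
  exists2 J : {set V}, s <= #|J| & connect (step_in W) I J.

(** The invariant speaks of all unblocked substitutes, not of a chosen one. When a token is added,
    the substitutes that remain were available before; when one is removed, a new substitute may be
    one that this token had blocked, and a third vertex mediates. *)
Lemma improvable_delete (I W K : {set V}) u :
  I \subset K -> K \subset W :\ u -> replaceable K u -> #|I| < s -> valid I ->
  improvable I W -> improvable I (W :\ u).
Proof.
move=> sIK sKW [F [sFK uF repl]] ltI vI [J leJ /connectP [p pth EJ]].
have uK : u \notin K by apply/negP => /(subsetP sKW); rewrite !inE eqxx.
have uI : u \notin I by apply: contra uK => /(subsetP sIK).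
have FW v : v \in F -> v \in W :\ u.
  by move=> vF; apply: (subsetP sKW); apply: (subsetP sFK).
set R := connect (step_in (W :\ u)).
pose good v (A : {set V}) := [/\ v \in F, v \notin A & [forall t in A, ~~ adj v t]].
(* The moves in [W] are simulated by keeping reachable all the sets in which [u]
   is replaced by some member of [F] that no other token blocks. *)
pose sim (X : {set V}) := (u \notin X -> R I X) /\
  (u \in X -> forall v, good v (X :\ u) -> R I (v |: (X :\ u))).
have simP X Y : valid X -> step_in W X Y -> sim X -> #|X| < s -> sim Y.
  move=> vX stXY [simX1 simX2] ltX; have /and5P [sXW sYW _ vY d1] := stXY.
  have [iX lX] := andP vX; have [iY lY] := andP vY.
  have subW (Z : {set V}) : Z \subset W -> u \notin Z -> Z \subset W :\ u.
    by move=> ? ?; rewrite subsetD1; apply/andP.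
  have R1 A v : R I A -> v \notin A -> v |: A \subset W :\ u ->
      independent (v |: A) -> l <= #|A| -> R I (v |: A).
    by move=> RA *; apply: connect_trans RA (connect1 _); apply: step_inU1.
  have R2 A v : R I (v |: A) -> v \notin A -> v |: A \subset W :\ u ->
      independent (v |: A) -> l <= #|A| -> R I A.
    move=> RA *; apply: connect_trans RA (connect1 _).
    by rewrite step_in_sym; apply: step_inU1.
  have nadju (Z : {set V}) t : independent Z -> u \in Z -> t \in Z -> adj t u ->
    t \in F.
    by move=> /independentP iZ uZ tZ; rewrite (negbTE (iZ _ _ tZ uZ)).
  case: (symdiff1P d1) => -[w wX EY].
    case: (eqVneq w u) EY wX => [->|nwu] EY wX.
      split; first by rewrite EY !inE eqxx.
      move=> _ v; rewrite EY setU1K // => -[vF vX' nv].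
      apply: R1 => //; first exact: simX1.
        apply/subsetP => x /setU1P [->|xX]; first exact: FW.
        by apply: (subsetP (subW _ sXW wX)).
      by rewrite independentU1 iX.
    split=> [uY|uY v].
      have uX : u \notin X by apply: contra uY; rewrite EY !inE => ->; rewrite orbT.
      apply: (connect_trans (simX1 uX)); apply: connect1.
      by rewrite /step_in !subW // vX vY.
    have uX : u \in X by move: uY; rewrite EY !inE eq_sym (negbTE nwu).
    have EYu : Y :\ u = w |: (X :\ u).
      rewrite EY; apply/setP => x; rewrite !inE.
      by case: eqP => [->|]; rewrite ?andbF // eq_sym (negbTE nwu).
    rewrite EYu => -[vF]; rewrite !inE negb_or => /andP [nvw vX'] /forall_inP nv.
    have gv : good v (X :\ u).
      by split; rewrite ?inE //; apply/forall_inP => t tX; apply: nv;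
        rewrite inE tX orbT.
    have := simX2 uX v gv => Rv.
    rewrite setUCA; apply: R1 => //.
    - by rewrite !inE negb_or eq_sym nvw negb_and wX orbT.
    - apply/subsetP => x; rewrite !in_setU1 => /or3P [/eqP ->|/eqP ->|].
      + by rewrite !inE nwu; apply: (subsetP sYW); rewrite EY !inE eqxx.
      + exact: FW.
      + by rewrite !inE => /andP [-> xX] /=; apply: (subsetP sXW).
    - rewrite setUCA -EYu independentU1 (independentS (subD1set _ _) iY) EYu.
      by apply/forall_inP.
    - rewrite cardsU1 !inE vX' add1n; rewrite (cardsD1 u) uX add1n in lX.
      exact: lX.
  have sYX : Y \subset X by rewrite EY subsetUr.
  have ltY : #|Y| < #|X| by rewrite EY cardsU1 wX.
  case: (eqVneq w u) EY wX => [->|nwu] EX wY.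
    split=> [_|]; last by rewrite (negbTE wY).
    (* Lifting the token from [u] is simulated by lifting it from a substitute, which [repl]
       provides. *)
    have [||v [vF vY' nv]] := repl Y; first by apply: ltn_trans ltX.
      move=> t tY atu; apply: (nadju X) => //; first by rewrite EX !inE eqxx.
      exact: (subsetP sYX).
    have gv : good v (X :\ u) by rewrite EX setU1K.
    have uX : u \in X by rewrite EX !inE eqxx.
    have := simX2 uX v gv; rewrite EX setU1K // => Rv.
    apply: R2 Rv vY' _ _ lY; last by rewrite independentU1 iY.
    apply/subsetP => x /setU1P [->|xX]; first exact: FW.
    by apply: (subsetP (subW _ sYW wY)).
  split=> [uY|uY v].
    have uX : u \notin X by rewrite EX !inE negb_or eq_sym nwu.
    apply: (connect_trans (simX1 uX)); apply: connect1.
    by rewrite /step_in !subW // vX vY.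
  have uX : u \in X by apply: (subsetP sYX).
  set A := Y :\ u; move=> [vF vA /forall_inP nv].
  have EXu : X :\ u = w |: A.
    rewrite EX; apply/setP => x; rewrite !inE.
    by case: eqP => [->|]; rewrite ?andbF // eq_sym (negbTE nwu).
  (* A token on [u] is moved from its substitute for [w |: A] to [v] by way of a
     [v'] that is compatible with both. *)
  have [||v' [vF' vT' /forall_inP nv']] := repl (v |: (w |: A)).
  - rewrite -EXu; rewrite (cardsD1 u X) uX in ltX.
    by apply: leq_ltn_trans ltX; rewrite cardsU1 leq_add2r; case: (_ \notin _).
  - move=> t; rewrite !in_setU1 => /or3P [/eqP -> //|/eqP ->|tA].
      by apply: (nadju X) => //; rewrite EX !inE eqxx.
    by apply: (nadju X) => //; move: tA; rewrite /A !inE => /andP [_ /(subsetP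
      sYX)].
  move: (vT'); rewrite !in_setU1 !negb_or => /and3P [nv'v nv'w v'A].
  have gv' : good v' (X :\ u).
    split; rewrite // EXu; first by rewrite in_setU1 negb_or nv'w.
    by apply/forall_inP => t tX; apply: nv'; rewrite in_setU1 tX orbT.
  have iA : independent A by exact: independentS (subD1set _ _) iY.
  have iX' : independent (w |: A) by rewrite -EXu;
    exact: independentS (subD1set _ _) iX.
  have AW x : x \in A -> x \in W :\ u.
    by rewrite !inE => /andP [-> xY]; apply: (subsetP sYW).
  have lA : l <= #|A|.+1 by move: lY; rewrite (cardsD1 u) uY.
  have wA : w \notin A by rewrite !inE negb_and wY orbT.
  have R_v' : R I (v' |: A).
    have := simX2 uX v' gv'; rewrite EXu setUCA => Rv.
    apply: R2 Rv _ _ _ _.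
    - by rewrite in_setU1 negb_or eq_sym nv'w.
    - apply/subsetP => x; rewrite !in_setU1 => /or3P [/eqP ->|/eqP ->|/AW //].
        by rewrite !inE nwu; apply: (subsetP sXW); rewrite EX !inE eqxx.
      exact: FW.
    - rewrite setUCA independentU1 iX'; apply/forall_inP => t tA; apply: nv'.
      by rewrite in_setU1 tA orbT.
    - by rewrite cardsU1 v'A add1n.
  have sW : v |: (v' |: A) \subset W :\ u.
    by apply/subsetP => x; rewrite !in_setU1 => /or3P [/eqP ->|/eqP ->|/AW //];
      exact: FW.
  have iv'A : independent (v' |: A).
    rewrite independentU1 iA; apply/forall_inP => t tA; apply: nv'.
    by rewrite !in_setU1 tA !orbT.
  have ivv'A : independent (v |: (v' |: A)).
    rewrite independentU1 iv'A; apply/forall_inP => t /setU1P [->|tA].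
      by rewrite adj_sym nv' // in_setU1 eqxx.
    exact: nv.
  have Rvv' : R I (v |: (v' |: A)).
    apply: R1 => //; last by rewrite cardsU1 v'A add1n.
    by rewrite in_setU1 negb_or eq_sym nv'v.
  rewrite setUCA in Rvv' sW ivv'A; apply: R2 Rvv' _ sW ivv'A _.
    by rewrite in_setU1 negb_or nv'v.
  by rewrite cardsU1 vA add1n.
have simI : sim I by split; [rewrite /R connect0 | rewrite (negbTE uI)].
(* Sizes change by one, so the walk meets size [s] exactly. Without [u] there remain [s - 1] tokens,
   few enough for one more substitute. *)
have fin X : sim X -> #|X| = s -> valid X -> improvable I (W :\ u).
  move=> [sim1 sim2] cX vX; case: (boolP (u \in X)) => [uX|/sim1 RX]; last first.
    by exists X; rewrite ?cX.
  have [||v gv] := repl (X :\ u); first by rewrite -cX (cardsD1 u X) uX.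
    move=> t; rewrite !inE => /andP [_ tX]; have [/independentP iX _] := andP vX.
    by rewrite (negbTE (iX _ _ tX uX)).
  exists (v |: (X :\ u)); last exact: sim2.
  by case: gv => _ vX' _; rewrite cardsU1 vX' -cX (cardsD1 u X) uX.
suff main X : path (step_in W) X p -> sim X -> #|X| < s -> valid X ->
    improvable I (W :\ u) \/ #|last X p| < s.
  by case: (main I) => //; rewrite -EJ ltnNge leJ.
elim: p X {pth EJ} => [|Y p IH] X /=; first by right.
case/andP => stXY pY simX ltX vX; have simY := simP _ _ vX stXY simX ltX.
have /and5P [_ _ _ vY /symdiff1P d1] := stXY.
have: #|Y| <= s.
  case: d1 => -[w wn E]; first by rewrite E cardsU1 wn.
  by apply: ltnW; apply: leq_ltn_trans ltX; rewrite E cardsU1 leq_addl.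
by rewrite leq_eqVlt => /predU1P [cY|ltY]; [left; exact: fin cY vY | exact: IH].
Qed.

(** The vertices outside [K] are deleted one at a time. Each deletion relies on substitutes in [K]
    only, so replaceability holds unchanged at every stage. *)
Lemma improvable_core (I K : {set V}) :
  I \subset K -> (forall u, u \notin K -> replaceable K u) ->
  #|I| < s -> valid I -> improvable I setT -> improvable I K.
Proof.
move=> sIK rK ltI vI.
have [m] := ubnP #|[set: V] :\: K|; have : K \subset setT by [].
elim: m [set: V] => // m IH W sKW ltm impW.
have [sWK|] := boolP (W \subset K).
  by rewrite (_ : K = W) //; apply/eqP; rewrite eqEsubset sKW.
case/subsetPn => u uW uK; apply: (IH (W :\ u)).
- by rewrite subsetD1 sKW.
- move: ltm; rewrite ltnS (cardsD1 u (W :\: K)) !inE uW uK.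
  by rewrite setDDl setUC -setDDl.
- by apply: (improvable_delete (K := K)) => //; [rewrite subsetD1 sKW | exact: rK].
Qed.

Lemma improvable_TAR (I : {set V}) : valid I ->
  (improvable I setT <->
   exists J : {set V}, [/\ independent J, s <= #|J| & TAR_reachable l I J]).
Proof.
move=> vI; split=> [[J leJ /connectP [p pth EJ]]|[J [iJ leJ [p [al pth EJ]]]]].
  have al : all valid (I :: p).
    elim: p I vI pth {EJ} => [|B p IH] A vA /=; first by rewrite vA.
    by case/andP => /and5P [_ _ _ vB _] /IH; rewrite vA /=; apply.
  exists J; split=> //.
    by move/allP/(_ J): al; rewrite EJ mem_last => /(_ isT) /andP [].
  exists p; split=> //; apply: sub_path pth => A B.
  by case/and5P.
exists J => //; apply/connectP; exists p => //.
elim: p I al pth {vI EJ} => //= B p IH A /andP [vA al] /andP [d1 pth].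
rewrite IH // andbT /step_in !subsetT d1 /valid vA.
by case/andP: al => ->.
Qed.

End Replacement.

(** * Sunflower search *)

Lemma uniq_map_inj_in (T T' : eqType) (f : T -> T') (s : seq T) :
  uniq [seq f x | x <- s] -> {in s &, injective f}.
Proof.
elim: s => // a s IH /= /andP [na us] x y.
move=> /predU1P [->|xs] /predU1P [->|ys] E //; last exact: IH.
  by case/negP: na; rewrite E map_f.
by case/negP: na; rewrite -E map_f.
Qed.

Section Core.

Variable G : graph.
Notation V := 'I_(nverts G).

Definition nbrs (R : seq V) (u : V) : seq V := [seq w <- R | adj u w].

(** An option written as a list of length at most one, the form in which the program returns it. *)
Definition pick_min (R t : seq V) : seq V :=
  foldr (fun h acc => if acc is b :: _ then
           if size (nbrs R h) <= size (nbrs R b) then [:: h] else acc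
         else [:: h]) [::] t.

(** The neighbours still present become the out-neighbours of the removed vertex. Once no vertex is
    left nothing changes, so the step can be iterated blindly. *)
Definition peel_step (st : seq V * seq (V * seq V)) :=
  if pick_min st.1 st.1 is u :: _ then
    ([seq w <- st.1 | u != w], (u, nbrs st.1 u) :: st.2)
  else st.

Definition peel (R : seq V) : seq (V * seq V) :=
  (iter (size R) peel_step (R, [::])).2.

(** The list itself is kept because it acts as a unary counter in the programs; its length takes the
    place of the degeneracy. *)
Definition longest (U : seq (V * seq V)) : seq V :=
  foldr (fun p q => if size p.2 <= size q then q else p.2) [::] U.

Definition apart (P Q : seq V) : bool := all (fun x => x \notin Q) P.

(** Without the cap [C] this is a maximal family of pairwise disjoint remainders; [C] of them
    already form the sunflower that is wanted. *)
Definition greedy (C : nat) (U : seq (V * seq V)) : seq (V * seq V) :=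
  foldr (fun p acc => if C <= size acc then acc
           else if all (fun q => apart p.2 q.2) acc then p :: acc else acc)
    [::] U.

(** The vertex [x] passes from the remainders to the common core. *)
Definition link (x : V) (U : seq (V * seq V)) : seq (V * seq V) :=
  [seq (p.1, [seq y <- p.2 | x != y]) | p <- U & x \in p.2].

Definition links (F U : seq (V * seq V)) : seq (seq (V * seq V)) :=
  flatten [seq [seq link x U | x <- p.2] | p <- F].

Definition level (C : nat) (st : seq V * seq (seq (V * seq V))) :=
  (flatten [seq [seq p.1 | p <- greedy C U] | U <- st.2] ++ st.1,
   flatten [seq links (greedy C U) U | U <- st.2]).

(** Starting from [I] protects the initial tokens from deletion. Remainders have between 0 and [m]
    elements and lose at least one per level, hence [m.+1] levels. *)
Definition core (C m : nat) (U : seq (V * seq V)) (I : seq V) : seq V :=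
  (iter m.+1 (level C) (I, [:: U])).1.

(** * Peeling yields an orientation of small out-degree *)

Lemma pick_min_nil R t : pick_min R t = [::] -> t = [::].
Proof. by case: t => //= h t; case: pick_min => // b r; case: ifP. Qed.

Lemma pick_minP R t u r : pick_min R t = u :: r ->
  u \in t /\ {in t, forall w, size (nbrs R u) <= size (nbrs R w)}.
Proof.
elim: t u r => //= h t IH u r; case E: pick_min => [|b q].
  move=> [<- _]; rewrite (pick_min_nil E) inE eqxx; split=> // w.
  by rewrite inE => /eqP ->.
have [bt bmin] := IH _ _ E; case: ifP => lehb [<- _].
  rewrite inE eqxx; split=> // w; rewrite inE => /predU1P [-> //|wt].
  exact: leq_trans lehb (bmin _ wt).
rewrite inE bt orbT; split=> // w; rewrite inE => /predU1P [->|]; last exact: bmin.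
by apply: ltnW; rewrite ltnNge lehb.
Qed.

Lemma degeneracyP : degenerate G (degeneracy G).
Proof. by rewrite /degeneracy; case: ex_minnP. Qed.

Definition orientation (U : seq (V * seq V)) : Prop :=
  [/\ uniq [seq p.1 | p <- U], forall u, u \in [seq p.1 | p <- U],
      {in U, forall p, size p.2 <= degeneracy G}
    & {in U &, forall p q, adj p.1 q.1 = (q.1 \in p.2) || (p.1 \in q.2)}].

Definition peel_inv (st : seq V * seq (V * seq V)) : Prop :=
  [/\ uniq (st.1 ++ [seq p.1 | p <- st.2]),
      forall u, u \in st.1 ++ [seq p.1 | p <- st.2],
      {in st.2, forall p, size p.2 <= degeneracy G},
      {in st.2 & st.1, forall p w, adj p.1 w = (w \in p.2)}
    & {in st.2 &, forall p q, adj p.1 q.1 = (q.1 \in p.2) || (p.1 \in q.2)}].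

(** The subgraph induced by [R] has some vertex of degree at most the degeneracy, and [u] has no
    more neighbours in it. *)
Lemma nbrs_min (R : seq V) u : uniq R -> u \in R ->
  {in R, forall w, size (nbrs R u) <= size (nbrs R w)} ->
  size (nbrs R u) <= degeneracy G.
Proof.
move=> uR uin mu; have /forallP/(_ [set x in R])/implyP := degeneracyP.
have -> : [set x in R] != set0 by apply/set0Pn; exists u; rewrite inE.
case/(_ isT)/existsP => v /andP []; rewrite inE => vR; apply: leq_trans.
apply: leq_trans (mu _ vR) _; rewrite -(card_uniqP (filter_uniq _ uR)).
by apply/subset_leq_card/subsetP => x; rewrite mem_filter !inE andbC.
Qed.

Lemma peel_step_inv st : peel_inv st ->
  peel_inv (peel_step st) /\ size (peel_step st).1 = (size st.1).-1.
Proof.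
case: st => R U inv; rewrite /peel_step /=.
case E: pick_min => [|u r] /=; first by rewrite (pick_min_nil E) /= in inv *.
have [uR mu] := pick_minP E.
case: inv => /=; rewrite cat_uniq => /and3P [uniR /hasPn disj uniU] cov leD adjR
  adjU.
have uU : u \notin [seq p.1 | p <- U] by apply/negP => /disj; rewrite /= uR.
have mR w : (w \in [seq x <- R | u != x]) = (u != w) && (w \in R).
  by rewrite mem_filter.
have Rnbr w : w \in R -> adj u w = (w \in nbrs R u).
  by move=> wR; rewrite mem_filter wR andbT.
split; last first.
  rewrite size_filter -(count_predC (pred1 u)) (count_uniq_mem _ uniR) uR.
  by apply: eq_count => x /=; rewrite eq_sym.
split=> /=.
- rewrite cat_uniq filter_uniq //= uniU uU !andbT mR eqxx negb_or /=.
  by apply/hasPn => x xU; rewrite /= mR negb_and (disj _ xU) orbT.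
- move=> x; have := cov x; rewrite !mem_cat mR inE [x == u]eq_sym; case: eqP => //=.
- move=> p /predU1P [-> /=|]; [exact: nbrs_min | exact: leD].
- move=> p w /predU1P [->|pU]; rewrite mR => /andP [_ wR]; first exact: Rnbr.
  exact: adjR.
have UR q : q \in U -> (q.1 \in nbrs R u) = false.
  move=> qU; rewrite mem_filter andbC; apply/negP => /andP [qR].
  by have := disj q.1 (map_f _ qU); rewrite /= qR.
move=> p q /predU1P [->|pU] /predU1P [->|qU] /=.
- by rewrite adj_irr mem_filter adj_irr.
- by rewrite UR // adj_sym (adjR q u).
- by rewrite UR // orbF (adjR p u).
- exact: adjU.
Qed.

Lemma peel_orientation R : uniq R -> (forall u, u \in R) -> orientation (peel R).
Proof.
move=> uR mR.
have inv m : let st := iter m peel_step (R, [::]) in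
    peel_inv st /\ size st.1 = size R - m.
  elim: m => [|m [IH1 IH2]] /=.
    by rewrite subn0; split=> //; split; rewrite /= ?cats0 // => ?.
  by have [? ->] := peel_step_inv IH1; rewrite IH2 subnS.
have [[uni cov leD _ adjU] sz0] := inv (size R).
rewrite subnn in sz0; rewrite (size0nil sz0) /= in uni cov.
by split.
Qed.

Lemma size_longest U p : p \in U -> size p.2 <= size (longest U).
Proof.
elim: U => //= q U IH /predU1P [->|/IH le1]; case: ifP => //.
by move=> /negbT; rewrite -ltnNge => /ltnW; apply: leq_trans le1.
Qed.

Lemma longest_le U m : {in U, forall p, size p.2 <= m} -> size (longest U) <= m.
Proof.
elim: U => //= q U IH le1; case: ifP => _; last by apply: le1; rewrite inE eqxx.
by apply: IH => p pU; apply: le1; rewrite inE pU orbT.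
Qed.

(** * Greedy families of disjoint remainders *)

Lemma greedy_subseq C U : subseq (greedy C U) U.
Proof.
elim: U => // p U IH; have sub := subseq_trans IH (subseq_cons U p).
rewrite [greedy _ _]/=; case: ifP => _ //; case: ifP => _ //.
by rewrite /= eqxx.
Qed.

Lemma size_greedy C U : size (greedy C U) <= C.
Proof. by elim: U => //= p U IH; case: (leqP C) => // ltC; case: ifP. Qed.

Lemma greedy_apart C U :
  pairwise (fun p q : V * seq V => apart p.2 q.2) (greedy C U).
Proof. by elim: U => //= p U IH; case: leqP => // _; case: ifP => //= ->. Qed.

(** The family only grows, so a final size below [C] means that the cap never acted: an entry was
    rejected only for meeting a chosen one. The first alternative is there for chosen entries with
    an empty remainder. *)
Lemma greedy_max C U p : size (greedy C U) < C -> p \in U ->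
  p \in greedy C U \/
  exists q x, [/\ q \in greedy C U, x \in p.2 & x \in q.2].
Proof.
elim: U => // r U IH; rewrite /= /apart.
case: (leqP C (size (greedy C U))) => [leC|ltC _]; first by rewrite ltnNge leC.
case: ifP => [_|/negbT /allPn [q qU /allPn [x xr /negbNE xq]]] /predU1P [->|pU].
- by left; rewrite inE eqxx.
- have [pg|[q [x [qg xp xq]]]] := IH ltC pU; first by left; rewrite inE pg orbT.
  by right; exists q, x; rewrite inE qg orbT.
- by right; exists q, x.
- exact: IH.
Qed.

Variables (U0 : seq (V * seq V)).

Definition arc (u w : V) : bool := has (fun p => (p.1 == u) && (w \in p.2)) U0.

(* A family [U] is aligned when the out-neighbourhoods of its vertices [p.1]
   all consist of a common core [Q] and of the remainder [p.2]. *)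
Definition aligned (U : seq (V * seq V)) (Q : pred V) : Prop :=
  uniq [seq p.1 | p <- U] /\
  {in U, forall p y, arc p.1 y = Q y || (y \in p.2)}.

(** [Q] is a predicate because the search never stores the core; it only strikes its vertices from
    the remainders. *)
Definition covered (C : nat) (out : seq V) (u : V) : Prop :=
  u \in out \/ exists (F : seq (V * seq V)) (Q : pred V),
    [/\ {subset [seq p.1 | p <- F] <= out}, C <= size F,
        pairwise (fun p q => apart p.2 q.2) F, aligned F Q
      & forall y, Q y -> arc u y].

Lemma aligned_subseq U U' Q : subseq U U' -> aligned U' Q -> aligned U Q.
Proof.
move=> sub [uni al]; split; first exact: subseq_uniq (map_subseq _ sub) uni.
by move=> p /(mem_subseq sub); apply: al.
Qed.

Lemma link_aligned x U Q : aligned U Q ->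
  aligned (link x U) (fun y => Q y || (y == x)).
Proof.
case=> uni al; split.
  rewrite -map_comp; apply: subseq_uniq uni.
  by rewrite (@eq_map _ _ _ fst) // map_subseq ?filter_subseq.
move=> r /mapP [p]; rewrite mem_filter => /andP [xp pU] -> y /=.
rewrite al // mem_filter -orbA [y == x]eq_sym; congr (_ || _).
by case: (eqVneq x y) => [<-|].
Qed.

Lemma level_mono C j st : {subset st.1 <= (iter j (level C) st).1}.
Proof.
elim: j => //= j IH u /IH; rewrite mem_cat => ->.
by rewrite orbT.
Qed.

(** Either the greedy family reaches [C] members, or, unless [p] is chosen itself, its remainder
    meets a chosen one in some [x], and [p] survives in [link x U], where all remainders are
    shorter. Shortening leaves [p.1] alone, the only part of [p] in the conclusion. *)
Lemma iter_level_covered C j st U Q p : U \in st.2 -> aligned U Q ->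
  {in U, forall q, size q.2 < j} -> p \in U ->
  covered C (iter j (level C) st).1 p.1.
Proof.
elim: j st U Q p => [|j IH] st U Q p Ust al lej pU; first by have := lej _ pU.
have grout : {subset [seq q.1 | q <- greedy C U] <= (level C st).1}.
  move=> u ug; rewrite mem_cat; apply/orP; left; apply/flatten_mapP.
  by exists U.
have [leC|ltC] := leqP C (size (greedy C U)).
  right; exists (greedy C U), Q; split=> //.
  - by move=> u /grout uo; rewrite iterSr; apply: level_mono.
  - exact: greedy_apart.
  - exact: aligned_subseq (greedy_subseq _ _) al.
  - by move=> y Qy; rewrite al.2 // Qy.
have [pg|[q [x [qg xp xq]]]] := greedy_max ltC pU.
  by left; rewrite iterSr; apply/level_mono/grout/map_f.
rewrite iterSr; pose p' := (p.1, [seq y <- p.2 | x != y]).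
rewrite -[p.1]/p'.1; apply: IH (link_aligned x al) _ _.
- apply/flatten_mapP; exists U => //; apply/flatten_mapP; exists q => //.
  exact: map_f.
- move=> r /mapP [r']; rewrite mem_filter => /andP [xr rU] -> /=.
  have := lej _ rU; rewrite ltnS; apply: leq_trans.
  rewrite size_filter -[X in _ < X](count_predC (fun y => x != y)).
  rewrite -[X in X < _]addn0 ltn_add2l -has_count; apply/hasP; exists x => //=.
  by rewrite eqxx.
- by apply/mapP; exists p => //; rewrite mem_filter xp.
Qed.

Lemma arcE p y : uniq [seq q.1 | q <- U0] -> p \in U0 ->
  arc p.1 y = (y \in p.2).
Proof.
move=> uni pU; apply/hasP/idP => [[q qU /andP [/eqP E yq]]|yp].
  by rewrite -(uniq_map_inj_in uni qU pU E).
by exists p => //; rewrite eqxx.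
Qed.

Lemma core_covered C m I u : orientation U0 ->
  {in U0, forall p, size p.2 <= m} -> covered C (core C m U0 I) u.
Proof.
move=> [uni cov _ _] lem; have /mapP [p pU ->] := cov u.
apply: (@iter_level_covered _ _ _ U0 pred0) => //; first by rewrite inE.
by split=> // q qU y; rewrite arcE.
Qed.

Lemma arc_out_le m t (vs : seq V) : orientation U0 ->
  {in U0, forall p, size p.2 <= m} -> uniq vs -> count (arc t) vs <= m.
Proof.
move=> [uni cov _ _] lem uv; have /mapP [p pU ->] := cov t.
rewrite -size_filter; apply: leq_trans (lem _ pU).
apply: uniq_leq_size; first exact: filter_uniq.
by move=> w; rewrite mem_filter arcE // => /andP [].
Qed.

Lemma pairwise_apart_count t (F : seq (V * seq V)) :
  pairwise (fun p q => apart p.2 q.2) F -> count (fun p => t \in p.2) F <= 1.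
Proof.
elim: F => //= p F IH /andP [/allP ap /IH le1].
case: (boolP (t \in p.2)) => //= tp; rewrite (_ : count _ _ = 0) //.
apply/eqP; rewrite eqn0Ngt -has_count; apply/hasPn => q /ap /allP /(_ _ tp).
by [].
Qed.

(* A token [t] blocks a member [p] of a covering family only if [t] is [p.1],
   lies in [p.2], or has an arc to [p.1]: at most [1 + 1 + m] members. *)
Lemma covered_replaceable s m (K : {set V}) out u : orientation U0 ->
  {in U0, forall p, size p.2 <= m} -> {subset out <= K} -> u \notin K ->
  covered (s * m.+2) out u -> replaceable s K u.
Proof.
move=> orU lem sK uK [/sK|]; first by rewrite (negbTE uK).
move=> [F [Q [Fout leF apF [uniF alF] Qu]]]; have [_ _ _ adjU] := orU.
have adjE v w : adj v w = arc v w || arc w v.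
  have [uni cov _ _] := orU.
  have /mapP [p pU ->] := cov v; have /mapP [q qU ->] := cov w.
  by rewrite adjU // !arcE.
exists [set v in [seq p.1 | p <- F]]; split.
- by apply/subsetP => v; rewrite inE => /Fout /sK.
- by rewrite inE; apply: contra uK => /Fout /sK.
move=> T ltT Tu.
case: (boolP (has (fun p => (p.1 \notin T) && [forall t in T, ~~ adj p.1 t]) F)).
  by case/hasP => p pF /andP [pT nadj]; exists p.1; rewrite inE map_f.
move/hasPn => bad; pose hits t (p : V * seq V) :=
  (p.1 == t) + (t \in p.2) + arc t p.1.
(* A token in the core would block every member. As a neighbour of [u] it would have to be a member
   itself, and since its out-neighbourhood contains the core, it would carry a loop. *)
have QT t : t \in T -> Q t -> False.
  move=> tT Qt; have atu : adj t u by rewrite adjE Qu ?orbT.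
  have := Tu t tT atu; rewrite inE => /mapP [p pF E].
  have : arc t t by rewrite {1}E alF // Qt.
  by move=> att; have := adj_irr t; rewrite adjE att.
have: size F <= \sum_(t in T) \sum_(p <- F) hits t p.
  rewrite exchange_big -sum1_size big_seq [X in _ <= X]big_seq /=.
  apply: leq_sum => p pF; have := bad _ pF.
  rewrite negb_and negbK => /orP [pT|/forall_inPn [t tT]].
    by rewrite (bigD1 p.1) //= /hits eqxx.
  rewrite negbK adjE alF // => hit; rewrite (bigD1 t) //=.
  suff: 0 < hits t p by move=> h; apply: leq_trans h (leq_addr _ _).
  rewrite /hits; case/orP: hit => [/orP [/(QT _ tT) //|->]|->]; lia.
have: \sum_(t in T) \sum_(p <- F) hits t p <= #|T| * m.+2.
  rewrite -sum_nat_const; apply: leq_sum => t tT.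
  have b1 (a : pred (V * seq V)) : \sum_(p <- F) a p = count a F.
    by rewrite -sum1_count [RHS]big_mkcond.
  rewrite !big_split /= !b1.
  apply: (@leq_trans (1 + 1 + m)); last by [].
  apply: leq_add; [apply: leq_add; last exact: pairwise_apart_count|].
    have := leq_b1 (t \in [seq p.1 | p <- F]).
    by rewrite -count_uniq_mem // count_map.
  by have := arc_out_le t orU lem uniF; rewrite count_map.
move=> le1 le2; have := leq_trans leF (leq_trans le2 le1).
by rewrite leq_pmul2r // leqNgt ltT.
Qed.

End Core.

(** * Exhaustive search *)

Section Search.

Variable G : graph.
Notation V := 'I_(nverts G).

(** * Growth of the sunflower search *)

Lemma size_link x (U : seq (V * seq V)) m : {in U, forall p, size p.2 <= m} ->
  size (link x U) <= size U /\ {in link x U, forall p, size p.2 <= m}.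
Proof.
move=> lem; split; first by rewrite size_map size_filter count_size.
move=> r /mapP [p]; rewrite mem_filter => /andP [_ pU] -> /=.
by apply: leq_trans (lem _ pU); rewrite size_filter count_size.
Qed.

Definition narrow (n m : nat) (U : seq (V * seq V)) : Prop :=
  size U <= n /\ {in U, forall p, size p.2 <= m}.

Lemma size_flatten_le (T T' : Type) (f : T -> seq T') (r : seq T) m :
  all (fun x => size (f x) <= m) r -> size (flatten [seq f x | x <- r]) <= size
    r * m.
Proof.
elim: r => //= x r IH /andP [le1 /IH le2].
by rewrite size_cat mulSn leq_add.
Qed.

Lemma size_links C U n m : narrow n m U ->
  size (links (greedy C U) U) <= C * m /\ {in links (greedy C U) U, forall U',
    narrow n m U'}.
Proof.
move=> [len lem]; split.
  apply: (@leq_trans (size (greedy C U) * m)); last first.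
    by rewrite leq_mul2r size_greedy orbT.
  apply: size_flatten_le; apply/allP => p pU; rewrite size_map; apply: lem.
  exact: (mem_subseq (greedy_subseq C U)).
move=> U' /flatten_mapP [p pU /mapP [x xp ->]].
have [le1 le2] := size_link x lem; split=> //; exact: leq_trans le1 len.
Qed.

Lemma size_level C st n m : {in st.2, forall U, narrow n m U} ->
  [/\ size (level C st).1 <= size st.1 + size st.2 * C,
      size (level C st).2 <= size st.2 * (C * m)
    & {in (level C st).2, forall U, narrow n m U}].
Proof.
move=> nst; split=> /=.
- rewrite size_cat addnC leq_add2l; apply: size_flatten_le.
  by apply/allP => U _; rewrite size_map size_greedy.
- by apply: size_flatten_le; apply/allP => U /nst /(size_links C) [].
- by move=> U' /flatten_mapP [U /nst /(size_links C) [_ H] /H].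
Qed.

(** A family opens at most [C * m] new ones, one for each vertex of a chosen remainder. The
    successor makes the powers monotone in [j], so that the last bound serves for all levels. *)
Lemma iter_level_size C n m j U I : narrow n m U ->
  let st := iter j (level C) (I, [:: U]) in
  let b := (C * m).+1 ^ j in
  [/\ size st.1 <= size I + j * b * C, size st.2 <= b
    & {in st.2, forall U, narrow n m U}].
Proof.
move=> nU /=; elim: j => [|j [IH1 IH2 IH3]].
  by rewrite expn0 addn0; split=> // U'; rewrite inE => /eqP ->.
rewrite iterS; have [le1 le2 H] := size_level C IH3; split=> //.
  have le3 := leq_mul IH2 (leqnn C); apply: leq_trans le1 (leq_trans (leq_add
    IH1 le3) _).
  rewrite -addnA leq_add2l -mulnDl addnC -mulSn leq_mul2r leq_mul2l leq_pexp2l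
    ?orbT //.
by apply: leq_trans le2 _; rewrite expnSr leq_mul.
Qed.

(** An addition needs no test against [l], since the set grows. Results are pushed onto [acc], which
    avoids concatenation. *)
Definition moves (l : nat) (K I : seq V) (acc : seq (seq V)) : seq (seq V) :=
  foldr (fun v acc => if v \in I then
           let J := [seq w <- I | v != w] in
           if l <= size J then J :: acc else acc
         else if all (fun w => ~~ adj v w) I then (v :: I) :: acc else acc)
    acc K.

(** Keeping [I] itself makes the iterates increase, so a fixed number of rounds covers all shorter
    walks. *)
Definition expand (l : nat) (K : seq V) (L : seq (seq V)) : seq (seq V) :=
  foldr (fun I acc => I :: moves l K I acc) [::] L.

(** The first test leaves [size I < s], on which both the deletions and the bound on the core
    depend. The number of rounds is at least the number of subsets of the core, hence at least the
    length of any walk without repetitions. *)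
Definition solve (l s : nat) (I R : seq V) : bool :=
  (s <= size I) ||
  let U := peel R in
  let m := size (longest U) in
  let K := core (s * m.+2) m U I in
  has (fun J => s <= size J) (iter (2 ^ size K) (expand l K) [:: I]).

Lemma movesP l K I acc J : J \in moves l K I acc <->
  [\/ J \in acc,
     exists v, [/\ v \in K, v \in I, J = [seq w <- I | v != w] & l <= size J]
   | exists v, [/\ v \in K, v \notin I, J = v :: I & all (fun w => ~~ adj v w) I]].
Proof.
elim: K => [|v K IH] /=.
  by split=> [Ja|[//|[v [//]]|[v [//]]]]; first by constructor 1.
have weak : J \in moves l K I acc ->
    [\/ J \in acc,
     exists w, [/\ w \in v :: K, w \in I, J = [seq x <- I | w != x] & l <= size J]
   | exists w, [/\ w \in v :: K, w \notin I, J = w :: I & all (fun x => ~~ adj w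
     x) I]].
  case/IH => [?|[w [wK ? ? ?]]|[w [wK ? ? ?]]]; first by constructor 1.
  - by constructor 2; exists w; rewrite inE wK orbT.
  - by constructor 3; exists w; rewrite inE wK orbT.
split.
  case: ifP => [vI|/negbT vI]; case: ifP => [H|_ /weak //].
    rewrite inE => /predU1P [E|/weak //]; constructor 2; exists v.
    by rewrite inE eqxx E.
  rewrite inE => /predU1P [E|/weak //]; constructor 3; exists v.
  by rewrite inE eqxx E.
have strong : J \in moves l K I acc -> J \in
    (if v \in I then
       if l <= size [seq w <- I | v != w]
       then [seq w <- I | v != w] :: moves l K I acc else moves l K I acc
     else if all (fun w => ~~ adj v w) I then (v :: I) :: moves l K I acc
     else moves l K I acc).
  by move=> Jm; case: ifP => _; case: ifP => _; rewrite ?inE Jm ?orbT.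
case=> [Ja|[w []]|[w []]]; first by apply/strong/IH; constructor 1.
  rewrite inE => /predU1P [-> vI -> le1|wK wI E le1];
    first by rewrite vI le1 inE eqxx.
  by apply/strong/IH; constructor 2; exists w.
rewrite inE => /predU1P [-> /negbTE -> -> ->|wK wI E nadj];
  first by rewrite inE eqxx.
by apply/strong/IH; constructor 3; exists w.
Qed.

Lemma expandP l K L J : J \in expand l K L <->
  exists2 I, I \in L & J = I \/ J \in moves l K I [::].
Proof.
elim: L => [|I L IH] /=; first by split=> // -[].
split.
  rewrite inE => /predU1P [->|/movesP H].
    by exists I; [rewrite inE eqxx | left].
  case: H => [/IH [I' I'L H]|H|H].
  - by exists I'; rewrite // inE I'L orbT.
  - by exists I; [rewrite inE eqxx | right; apply/movesP; constructor 2].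
  - by exists I; [rewrite inE eqxx | right; apply/movesP; constructor 3].
case=> I'; rewrite inE => /predU1P [->|I'L] H.
  case: H => [->|/movesP H]; first by rewrite inE eqxx.
  rewrite inE; apply/orP; right; apply/movesP.
  by case: H => // H; [constructor 2 | constructor 3].
by rewrite inE; apply/orP; right; apply/movesP; constructor 1; apply/IH; exists I'.
Qed.

Notation toset I := [set x in I].

Lemma toset_rem v (I : seq V) : toset [seq w <- I | v != w] = toset I :\ v.
Proof. by apply/setP => x; rewrite !inE mem_filter eq_sym. Qed.

Lemma toset_cons v (I : seq V) : toset (v :: I) = v |: toset I.
Proof. by apply/setP => x; rewrite !inE. Qed.

Lemma card_toset (I : seq V) : uniq I -> #|toset I| = size I.
Proof. by move=> /card_uniqP <-; apply: eq_card => x; rewrite inE. Qed.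

(** Every move in [K] is a move in the whole graph, hence [setT]: only completeness depends on the
    choice of [K]. The lists stay duplicate-free so that [size] counts tokens. *)
Lemma expand_sound l K L (I0 : {set V}) :
  {in L, forall I, [/\ uniq I, valid l (toset I) & connect (step_in l setT) I0
    (toset I)]} ->
  {in expand l K L, forall I, [/\ uniq I, valid l (toset I) & connect (step_in l
    setT) I0 (toset I)]}.
Proof.
move=> HL J /expandP [I /HL [uI vI cI] [-> //|/movesP [//|[v [vK vI' EJ lJ]]|[v
  [vK vI' EJ nadj]]]]].
  have uJ : uniq J by rewrite EJ filter_uniq.
  have EI : toset I = v |: toset J by rewrite EJ toset_rem setD1K // inE.
  have st : step_in l setT (toset J) (toset I).
    rewrite EI; apply: step_inU1; rewrite ?subsetT //; last by rewrite card_toset.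
      by rewrite EJ inE mem_filter eqxx.
    by rewrite -EI; case/andP: vI.
  split=> //; first by case/and5P: st.
  by apply: connect_trans cI (connect1 _); rewrite step_in_sym.
have uJ : uniq J by rewrite EJ /= vI'.
have st : step_in l setT (toset I) (toset J).
  rewrite EJ toset_cons; apply: step_inU1; rewrite ?subsetT ?inE //.
    rewrite independentU1; case/andP: vI => -> _; apply/forall_inP => x.
    by rewrite inE => xI; apply: (allP nadj).
  by case/andP: vI.
split=> //; first by case/and5P: st.
exact: connect_trans cI (connect1 st).
Qed.

Lemma iter_expand_sound l K (I : seq V) j : uniq I -> valid l (toset I) ->
  {in iter j (expand l K) [:: I], forall J,
    [/\ uniq J, valid l (toset J) & connect (step_in l setT) (toset I) (toset J)]}.
Proof.
move=> uI vI; elim: j => [|j IH]; last exact: expand_sound.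
by move=> J'; rewrite inE => /eqP ->; split.
Qed.

Lemma size_expand l K L : size (expand l K L) <= size L * (size K).+1.
Proof.
have le1 I acc : size (moves l K I acc) <= size K + size acc.
  elim: K => //= v K' IH; rewrite addSn; case: ifP => _; case: ifP => _ //;
    exact: leq_trans IH (leqnSn _).
elim: L => //= I L IH; rewrite mulSn addSn ltnS.
exact: leq_trans (le1 _ _) (leq_add (leqnn _) IH).
Qed.

(** Equal sets reached in several ways are not merged. This is affordable: for [j = 2 ^ size K] the
    bound depends on the size of [K] alone. *)
Lemma size_iter_expand l K I j :
  size (iter j (expand l K) [:: I]) <= (size K).+1 ^ j.
Proof.
elim: j => // j IH; rewrite iterS expnSr; apply: leq_trans (size_expand _ _ _) _.
by rewrite leq_mul2r IH orbT.
Qed.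

(** A set can be listed in several orders, so the list found is determined only up to [toset]. *)
Lemma expand_complete l K L p (I : seq V) : I \in L -> uniq I ->
  path (step_in l (toset K)) (toset I) p ->
  exists J, [/\ J \in iter (size p) (expand l K) L, uniq J
    & toset J = last (toset I) p].
Proof.
elim: p L I => [|B p IH] L I IL uI /=; first by exists I.
case/andP => /and5P [sIK sBK vI vB /symdiff1P d1].
suff [J [JL uJ ->]] : exists J, [/\ J \in expand l K L, uniq J & B = toset J].
  by move=> /(IH _ _ JL uJ) [J']; rewrite -iterSr; exists J'.
case: d1 => -[w wn E].
  exists (w :: I); rewrite toset_cons /= uI andbT; rewrite inE in wn.
  split=> //; apply/expandP; exists I => //; right; apply/movesP; constructor 3.
  exists w; split=> //.
    by have := subsetP sBK w; rewrite E !inE eqxx; apply.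
  have /andP [iB _] := vB; rewrite E independentU1 in iB.
  by apply/allP => x xI; have /andP [_ /forall_inP] := iB; apply; rewrite inE.
have wI : w \in I by have := setU11 w B; rewrite -E inE.
have EB : B = toset [seq x <- I | w != x] by rewrite toset_rem E setU1K.
exists [seq x <- I | w != x]; rewrite filter_uniq //; split=> //.
apply/expandP; exists I => //; right; apply/movesP; constructor 2.
exists w; split=> //; first by have := subsetP sIK w; rewrite !inE wI; apply.
by case/andP: vB => _; rewrite EB card_toset // filter_uniq.
Qed.

Lemma expand_mono l K i j L : i <= j ->
  {subset iter i (expand l K) L <= iter j (expand l K) L}.
Proof.
move/subnKC <-; rewrite addnC iterD => J; elim: (j - i) => //= m IH /IH JL.
by apply/expandP; exists J; [|left].
Qed.

Lemma solveP l s (I R : seq V) : uniq R -> (forall u, u \in R) ->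
  uniq I -> valid l (toset I) ->
  solve l s I R <-> exists J : {set V},
    [/\ independent J, s <= #|J| & TAR_reachable l (toset I) J].
Proof.
move=> uR mR uI vI; rewrite -improvable_TAR // /solve.
have [le_sI|lt_Is] /= := leqP s (size I).
  by split=> // _; exists (toset I); rewrite ?connect0 ?card_toset.
set U := peel R; set m := size (longest U).
set K := core _ _ _ _.
have orU : orientation U by apply: peel_orientation.
have leU : {in U, forall p, size p.2 <= m} by move=> p; apply: size_longest.
split=> [/hasP [J JL leJ]|].
  have [uJ _ cJ] := iter_expand_sound uI vI JL.
  by exists (toset J); rewrite ?card_toset.
have sIK : toset I \subset toset K.
  by apply/subsetP => x; rewrite !inE => xI; apply: (@level_mono _ _ _ (I, [:: U])).
have rK u : u \notin toset K -> replaceable s (toset K) u.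
  move=> uK; apply: covered_replaceable orU leU _ uK (core_covered _ I _ orU leU).
  by move=> x xo; rewrite inE.
move/(improvable_core sIK rK); rewrite card_toset // => /(_ lt_Is vI).
case=> J leJ /connectP [p0 pth0 EJ0].
have [p pth EJ] : exists2 p, path (step_in l (toset K)) (toset I) p /\ size p <=
  2 ^ size K
    & J = last (toset I) p.
  rewrite EJ0; case: (shortenP pth0) => p pth up _; exists p => //; split=> //.
  have sub : {subset p <= powerset (toset K)}.
    elim: p {up EJ0} (toset I) pth => //= B p IH A /andP [/and5P [_ sB _ _ _]
      /IH H] X.
    by rewrite inE => /predU1P [->|/H //]; rewrite inE.
  case/andP: up => _ up; rewrite -(card_uniqP up).
  apply: leq_trans (subset_leq_card (introT subsetP sub)) _.
  by rewrite card_powerset leq_exp2l // cardsE card_size.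
case: pth => pth lep.
have [J' [J'L uJ' EJ']] := expand_complete (mem_head I [::]) uI pth.
apply/hasP; exists J'; first exact: expand_mono lep _ J'L.
by rewrite -card_toset // EJ' -EJ.
Qed.

End Search.

(** * Programs *)

(** Value and loop bound are established together, since the lengths of later folds depend on values
    computed before. *)
Definition spec (S : nat) (t : tm) (env : seq data) (v : data) : Prop :=
  den t env = v /\ folds_le S t env.

(* The arguments of the programs below are their variables 0, 1, ...  The second
   branch of [TCase], which is the one taken on [true], and the body of [TFold]
   bind two more variables. *)
Definition TTrue : tm := TNode TLeaf TLeaf.

(** Arguments are passed by building a pair and taking it apart at once. Inner pairs stay in the
    environment, so the variables of the caller shift by 2, 4 and 6 in the three variants. *)
Definition TCall2 (e1 e2 f : tm) : tm := TCase (TNode e1 e2) TLeaf f.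

Definition TCall3 (e1 e2 e3 f : tm) : tm :=
  TCase (TNode e3 (TNode e1 e2)) TLeaf (TCase 1 TLeaf f).

Definition TCall4 (e1 e2 e3 e4 f : tm) : tm :=
  TCase (TNode (TNode e1 e2) (TNode e3 e4)) TLeaf
    (TCase 1 TLeaf (TCase 2 TLeaf f)).

Section Rules.

Variable S : nat.
Implicit Types (t : tm) (env : seq data) (v x y : data).

Lemma spec_eq t env v v' : spec S t env v -> v = v' -> spec S t env v'.
Proof. by move=> ? <-. Qed.

Lemma spec_node a b env x y :
  spec S a env x -> spec S b env y -> spec S (TNode a b) env (Node x y).
Proof. by case=> da oa [db ob]; split; rewrite /= ?da ?db. Qed.

Lemma spec_case_leaf e e1 e2 env v :
  spec S e env Leaf -> spec S e1 env v -> spec S (TCase e e1 e2) env v.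
Proof. by case=> de oe [d1 o1]; split; rewrite /= ?de. Qed.

Lemma spec_case_node e e1 e2 env x y v :
  spec S e env (Node x y) -> spec S e2 [:: x, y & env] v ->
  spec S (TCase e e1 e2) env v.
Proof. by case=> de oe [d1 o1]; split; rewrite /= ?de. Qed.

Lemma spec_if (b : bool) e e1 e2 env v : spec S e env (enc_bool b) ->
  (~~ b -> spec S e1 env v) -> (b -> spec S e2 [:: Leaf, Leaf & env] v) ->
  spec S (TCase e e1 e2) env v.
Proof.
case: b => se s1 s2; first exact: spec_case_node se (s2 isT).
exact: spec_case_leaf se (s1 isT).
Qed.

Lemma spec_call2 e1 e2 f env v1 v2 v : spec S e1 env v1 -> spec S e2 env v2 ->
  spec S f [:: v1, v2 & env] v -> spec S (TCall2 e1 e2 f) env v.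
Proof. by move=> s1 s2; apply/spec_case_node/spec_node. Qed.

Lemma spec_call3 e1 e2 e3 f env v1 v2 v3 v :
  spec S e1 env v1 -> spec S e2 env v2 -> spec S e3 env v3 ->
  spec S f [:: v1, v2, v3, Node v1 v2 & env] v -> spec S (TCall3 e1 e2 e3 f) env v.
Proof.
move=> s1 s2 s3 sf; apply: spec_case_node (spec_node s3 (spec_node s1 s2)) _.
exact: (@spec_case_node _ _ _ _ v1 v2).
Qed.

Lemma spec_call4 e1 e2 e3 e4 f env v1 v2 v3 v4 v :
  spec S e1 env v1 -> spec S e2 env v2 -> spec S e3 env v3 -> spec S e4 env v4 ->
  spec S f [:: v1, v2, v3, v4, Node v1 v2, Node v3 v4 & env] v ->
  spec S (TCall4 e1 e2 e3 e4 f) env v.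
Proof.
move=> s1 s2 s3 s4 sf.
apply: spec_case_node (spec_node (spec_node s1 s2) (spec_node s3 s4)) _.
apply: (@spec_case_node _ _ _ _ v3 v4) => //.
exact: (@spec_case_node _ _ _ _ v1 v2).
Qed.

Lemma spine_seq (xs : seq data) : spine (enc_seq xs) = size xs.
Proof. by elim: xs => //= x xs ->. Qed.

Lemma spine_nat n : spine (enc_nat n) = n.
Proof. by elim: n => //= n ->. Qed.

(** A right fold meets the suffixes of [ys], so the invariant [r] is indexed by them; the prefix [p]
    is recorded so that facts about all of [ys] apply to [z] and [zs]. *)
Lemma spec_fold (Y : Type) (e : Y -> data) (ys : seq Y) (r : seq Y -> data)
    l b s env :
  spec S l env (enc_seq [seq e z | z <- ys]) -> size ys <= S ->
  spec S b env (r [::]) ->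
  (forall p z zs, ys = p ++ z :: zs -> spec S s [:: e z, r zs & env] (r (z ::
    zs))) ->
  spec S (TFold l b s) env (r ys).
Proof.
case=> dl ol leS [db ob] Hs.
suff [E o] : dfold (r [::]) (fun h a => den s [:: h, a & env])
    (enc_seq [seq e z | z <- ys]) = r ys /\
  fold_all (r [::]) (fun h a => den s [:: h, a & env])
    (fun h a => folds_le S s [:: h, a & env]) (enc_seq [seq e z | z <- ys]).
  by split; rewrite /= dl db ?E //; split; rewrite // spine_seq size_map.
elim: ys Hs {dl leS} => [|z zs IH] Hs; first by [].
have [|E o] := IH; first by move=> p z' zs' E; apply: (Hs (z :: p)); rewrite E.
have [ds os] := Hs [::] z zs (erefl _).
by rewrite /= E.
Qed.

(** For lists that serve as unary counters: only the length matters, and the entry [h] is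
    arbitrary. *)
Lemma spec_iter x (r : nat -> data) l b s env :
  spec S l env x -> spine x <= S -> spec S b env (r 0) ->
  (forall h i, i < spine x -> spec S s [:: h, r i & env] (r i.+1)) ->
  spec S (TFold l b s) env (r (spine x)).
Proof.
case=> dl ol leS [db ob] Hs.
suff [E o] : dfold (r 0) (fun h a => den s [:: h, a & env]) x = r (spine x) /\
    fold_all (r 0) (fun h a => den s [:: h, a & env])
      (fun h a => folds_le S s [:: h, a & env]) x.
  by split; rewrite /= dl db ?E //; split.
elim: x Hs {dl leS} => //= h _ t IH Hs.
have [|-> o] := IH; first by move=> h' i lti; apply: Hs; apply: ltnW.
by have [? ?] := Hs h (spine t) (leqnn _).
Qed.

End Rules.

(** * Programs for the steps of the algorithm *)

Definition tail (x : data) : data := if x is Node _ b then b else Leaf.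

Definition TTail (e : tm) : tm := TCase e TLeaf 1.

(* [fun x y => spine x <= spine y] *)
Definition TLe : tm :=
  TCase (TFold 0 (TNode TLeaf 1) (TTail 1)) TLeaf TTrue.

Definition TEq : tm :=
  TCase (TCall2 0 1 TLe) TLeaf (TCall2 3 2 TLe).

Definition TMem : tm :=
  TFold 1 TLeaf (TCase (TCall2 2 0 TEq) 1 TTrue).

Definition TNth : tm :=
  TCase (TFold 0 1 (TTail 1)) TLeaf 0.

Definition TAdj : tm := TCall2 1 (TCall2 0 2 TNth) TNth.

Definition TNbrs : tm :=
  TFold 1 TLeaf
    (TCase (TCall3 2 0 4 TAdj) 1 (TNode 2 3)).

Definition TPick : tm :=
  TFold 0 TLeaf
    (TCase 1 (TNode 0 TLeaf)
      (TCase (TCall2 (TCall3 2 4 5 TNbrs)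
                     (TCall3 0 4 5 TNbrs) TLe)
        3 (TNode 4 TLeaf))).

Definition TRem : tm :=
  TFold 1 TLeaf
    (TCase (TCall2 2 0 TEq) (TNode 0 1) 3).

Definition TPeel : tm :=
  TFold 0 (TNode 0 TLeaf)
    (TCase 1 TLeaf
      (TCase (TCall2 0 5 TPick) 3
        (TNode (TCall2 0 2 TRem)
           (TNode (TNode 0 (TCall3 0 2 7 TNbrs)) 3)))).

Definition TLongest : tm :=
  TFold 0 TLeaf
    (TCase 0 TLeaf (TCase (TCall2 1 3 TLe) 1 5)).

Definition TCap : tm :=
  TFold 0 TLeaf (TNode TLeaf (TNode TLeaf (TFold 3 1 (TNode TLeaf 1)))).

Definition TApart : tm :=
  TFold 0 TTrue (TCase (TCall2 0 3 TMem) 1 TLeaf).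

Definition TApartAll : tm :=
  TFold 1 TTrue
    (TCase 0 TLeaf (TCase (TCall2 4 1 TApart) TLeaf 5)).

Definition TGreedy : tm :=
  TFold 0 TLeaf
    (TCase (TCall2 3 1 TLe)
      (TCase 0 TLeaf
        (TCase (TCall2 1 3 TApartAll) 3 (TNode 4 5)))
      3).

Definition TLink : tm :=
  TFold 1 TLeaf
    (TCase 0 TLeaf
      (TCase (TCall2 4 1 TMem) 3
        (TNode (TNode 2 (TCall2 6 3 TRem)) 5))).

(** The third argument is the tail onto which the links are pushed; this replaces a
    concatenation. *)
Definition TLinks : tm :=
  TFold 0 2
    (TCase 0 TLeaf
      (TFold 1 3 (TNode (TCall2 0 7 TLink) 1))).

Definition TFirsts : tm :=
  TFold 0 1 (TCase 0 TLeaf (TNode 0 3)).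

Definition TLevel : tm :=
  TCase 0 TLeaf
    (TNode
      (TFold 1 0
        (TCall2 (TCall2 0 5 TGreedy) 1 TFirsts))
      (TFold 1 TLeaf
        (TCall3 (TCall2 0 5 TGreedy) 0 1 TLinks))).

(** The node placed in front of the third argument turns its length [m] into the [m.+1] rounds of
    [core]. *)
Definition TCore : tm :=
  TCase (TFold (TNode TLeaf 2) (TNode 3 (TNode 0 TLeaf))
           (TCall2 1 3 TLevel)) TLeaf 0.

Definition TPow2 : tm :=
  TFold 0 TTrue (TFold 1 1 (TNode TLeaf 1)).

Definition TNonadj : tm :=
  TFold 1 TTrue (TCase (TCall3 2 0 4 TAdj) 1 TLeaf).

Definition TExpand : tm :=
  TFold 0 TLeaf
    (TNode 0
      (TFold 3 1
        (TCase (TCall2 0 2 TMem)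
          (TCase (TCall3 0 2 7 TNonadj) 1
            (TNode (TNode 2 4) 3))
          (TCase (TCall2 8 (TCall2 2 4 TRem) TLe) 3
            (TNode (TCall2 4 6 TRem) 5))))).

Definition TLarge : tm :=
  TFold 0 TLeaf (TCase (TCall2 3 0 TLe) 1 TTrue).

(** The length of the list built so far is the next vertex number, so the vertices come out in
    decreasing order. *)
Definition TVerts : tm :=
  TFold 0 TLeaf (TNode (TFold 1 TLeaf (TNode TLeaf 1)) 1).

Definition TSelect : tm :=
  TFold 0 TLeaf (TCase (TCall2 0 3 TNth) 1 (TNode 2 3)).

(** * Correctness of the programs on vertex lists *)

Section ListPrograms.

Variables (G : graph) (S : nat).
Hypothesis leGS : nverts G <= S.
Notation vert := 'I_(nverts G).
Implicit Types (env : seq data) (x y : data) (u v : vert) (R I P Q K : seq vert)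
  (U F : seq (vert * seq vert)).

Definition enc_vert (v : vert) : data := enc_nat v.
Definition enc_verts (I : seq vert) : data := enc_seq [seq enc_vert v | v <- I].
Definition enc_entry (p : vert * seq vert) : data :=
  Node (enc_vert p.1) (enc_verts p.2).
Definition enc_family (U : seq (vert * seq vert)) : data :=
  enc_seq [seq enc_entry p | p <- U].
Definition enc_families Us : data := enc_seq [seq enc_family U | U <- Us].
Definition enc_states (L : seq (seq vert)) : data :=
  enc_seq [seq enc_verts J | J <- L].

Lemma spine_vert v : spine (enc_vert v) = v. Proof. exact: spine_nat. Qed.
Lemma spine_vert_le v : spine (enc_vert v) <= S.
Proof. by rewrite spine_vert (leq_trans (ltnW (ltn_ord v))). Qed.
Lemma spine_verts I : spine (enc_verts I) = size I.
Proof. by rewrite spine_seq size_map. Qed.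
Lemma spine_family U : spine (enc_family U) = size U.
Proof. by rewrite spine_seq size_map. Qed.

Lemma spec_tail e env x : spec S e env x -> spec S (TTail e) env (tail x).
Proof.
by case: x => [|a b] H; [apply: spec_case_leaf H _ | apply: spec_case_node H _].
Qed.

Lemma spine_iter_tail n x : spine (iter n tail x) = spine x - n.
Proof.
elim: n => [|n IH] /=; first by rewrite subn0.
by rewrite subnS -IH; case: (iter n tail x).
Qed.

(** [Node Leaf y] is one node longer than [y], so after [spine x] tails a node is left exactly when
    [spine x <= spine y]. *)
Lemma spec_le x y env : spine x <= S ->
  spec S TLe [:: x, y & env] (enc_bool (spine x <= spine y)).
Proof.
move=> leS.
have H : spec S (TFold 0 (TNode TLeaf 1) (TTail 1)) [:: x, y & env]
    (iter (spine x) tail (Node Leaf y)).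
  apply: (spec_iter (r := fun i => iter i tail (Node Leaf y))) => // h i _.
  exact: spec_tail.
have := spine_iter_tail (spine x) (Node Leaf y).
case: (iter _ _ _) H => [|a b] H /= E.
  by rewrite -ltnS -subn_gt0 -E; apply: spec_case_leaf H _.
rewrite -ltnS -subn_gt0 -E; exact: spec_case_node H _.
Qed.

Lemma spec_and e1 e2 env (b1 b2 : bool) : spec S e1 env (enc_bool b1) ->
  (b1 -> spec S e2 [:: Leaf, Leaf & env] (enc_bool b2)) ->
  spec S (TCase e1 TLeaf e2) env (enc_bool (b1 && b2)).
Proof. by move=> s1 s2; apply: spec_if s1 _ _; case: b1 s2 => // H _; apply: H. Qed.

Lemma spec_leq m n x y env : spine x = m -> spine y = n -> m <= S ->
  spec S TLe [:: x, y & env] (enc_bool (m <= n)).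
Proof. by move=> <- <-; apply: spec_le. Qed.

Lemma spec_veq u v env : spec S TEq [:: enc_vert u, enc_vert v & env] (enc_bool
  (u == v)).
Proof.
have -> : (u == v) = (spine (enc_vert u) <= spine (enc_vert v) <= spine
  (enc_vert u)).
  by rewrite !spine_vert -eqn_leq.
apply: spec_and => [|_].
  by apply: spec_call2 (spec_le _ _ (spine_vert_le u)).
by apply: spec_call2 (spec_le _ _ (spine_vert_le v)).
Qed.

Lemma spec_mem u R env : size R <= S ->
  spec S TMem [:: enc_vert u, enc_verts R & env] (enc_bool (u \in R)).
Proof.
move=> leR; apply: (spec_fold (r := fun R => enc_bool (u \in R)) (e :=
  enc_vert)) => //.
move=> _ v t _; rewrite inE; apply: spec_if (_ : spec S _ _ (enc_bool (u == v)))
  _ _.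
- exact: spec_call2 (spec_veq _ _ _).
- by move=> /negbTE ->.
- by move=> ->.
Qed.

Lemma spec_nth i xs env : i <= S ->
  spec S TNth [:: enc_nat i, enc_seq xs & env] (nth Leaf xs i).
Proof.
move=> leS; apply: (@spec_eq _ _ _ (if iter (spine (enc_nat i)) tail (enc_seq
  xs) is Node a _ then a else Leaf)).
  set z := iter _ _ _.
  have H : spec S (TFold 0 1 (TTail 1)) [:: enc_nat i, enc_seq xs & env] z.
    apply: (spec_iter (r := fun i => iter i tail (enc_seq xs))) => //.
      by rewrite spine_nat.
    by move=> h j _; apply: spec_tail.
  by case: z H => [|a b] H; [apply: spec_case_leaf H _ | apply: spec_case_node H _].
rewrite spine_nat; elim: i xs {leS} => [|i IH] [|a xs] //.
  by rewrite nth_nil -[RHS](nth_nil _ i) -IH iterSr.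
by rewrite iterSr /= IH.
Qed.

Lemma spec_adj u v env : spec S TAdj [:: enc_vert u, enc_vert v, (enc_graph G) &
  env] (enc_bool (adj u v)).
Proof.
have le w : val w <= S := leq_trans (ltnW (ltn_ord w)) leGS.
pose row w := [seq enc_bool (adj w z) | z <- enum vert].
pose rows := [seq enc_seq (row w) | w <- enum vert].
have Eu : nth Leaf rows u = enc_seq (row u).
  by rewrite (nth_map u) ?size_enum_ord // nth_ord_enum.
have Euv : nth Leaf (row u) v = enc_bool (adj u v).
  by rewrite (nth_map u) ?size_enum_ord // nth_ord_enum.
rewrite -Euv; apply: (@spec_call2 _ _ _ _ _ (enc_vert v) (enc_seq (row u))) => //.
  rewrite -Eu; apply: (@spec_call2 _ _ _ _ _ (enc_vert u) (enc_graph G)) => //.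
  exact: (spec_nth rows _ (le u)).
exact: (spec_nth (row u) _ (le v)).
Qed.

Lemma spec_nbrs u R env : size R <= S ->
  spec S TNbrs [:: enc_vert u, enc_verts R, (enc_graph G) & env] (enc_verts
    (nbrs R u)).
Proof.
move=> leR; apply: (spec_fold (r := fun R => enc_verts (nbrs R u)) (e :=
  enc_vert)) => //.
move=> _ v t _; rewrite /=; apply: spec_if (_ : spec S _ _ (enc_bool (adj u v)))
  _ _.
- exact: spec_call3 (spec_adj _ _ _).
- by move=> /negbTE ->.
- by move=> ->.
Qed.

Lemma size_nbrs R u : size (nbrs R u) <= size R.
Proof. by rewrite size_filter count_size. Qed.

Lemma spec_pick R env : size R <= S ->
  spec S TPick [:: enc_verts R, (enc_graph G) & env] (enc_verts (pick_min R R)).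
Proof.
move=> leR; apply: (spec_fold (r := fun t => enc_verts (pick_min R t)) (e :=
  enc_vert)) => //.
move=> _ u t _ /=; case E: pick_min => [|b q]; first exact: spec_case_leaf.
apply: (@spec_case_node _ _ _ _ _ (enc_vert b) (enc_verts q)) => //.
apply: spec_if (_ : spec S _ _ (enc_bool (size (nbrs R u) <= size (nbrs R b)))) _ _.
- apply: spec_call2; [exact: spec_call3 (spec_nbrs _ _ leR)..|].
  rewrite -!spine_verts; apply: spec_le; rewrite spine_verts.
  exact: leq_trans (size_nbrs _ _) leR.
- by move=> /negbTE ->.
- by move=> ->.
Qed.

Lemma spec_rem u R env : size R <= S ->
  spec S TRem [:: enc_vert u, enc_verts R & env] (enc_verts [seq v <- R | u != v]).
Proof.
move=> leR; apply: (spec_fold (r := fun R => enc_verts [seq v <- R | u != v]) (e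
  := enc_vert)) => //.
move=> _ v t _; rewrite /=; apply: spec_if (_ : spec S _ _ (enc_bool (u == v))) _ _.
- exact: spec_call2 (spec_veq _ _ _).
- by move=> ->.
- by move=> ->.
Qed.

Lemma spec_peel R env : size R <= S ->
  spec S (TCase TPeel TLeaf 1) [:: enc_verts R, (enc_graph G) & env] (enc_family
    (peel R)).
Proof.
move=> leR; rewrite /peel.
pose st i := iter i (@peel_step G) (R, [::]).
apply: (@spec_case_node _ _ _ _ _ (enc_verts (st (size R)).1) (enc_family (st
  (size R)).2)) => //.
rewrite -[size R]spine_verts.
apply: (spec_iter (r := fun i => Node (enc_verts (st i).1) (enc_family (st
  i).2))) => //.
  by rewrite spine_verts.
move=> h i _; have: size (st i).1 <= S.
  apply: leq_trans leR; rewrite /st; elim: i => //= i; apply: leq_trans.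
  by rewrite /peel_step; case: pick_min => //= *; rewrite size_filter count_size.
rewrite (_ : st i.+1 = peel_step (st i)) //; case: (st i) => R' U' /= leR'.
apply: (@spec_case_node _ _ _ _ _ (enc_verts R') (enc_family U')) => //.
set env' := [:: enc_verts R', _ & _].
have: spec S (TCall2 0 5 TPick) env' (enc_verts (pick_min R' R')).
  by apply: (@spec_call2 _ _ _ _ _ (enc_verts R') (enc_graph G)) => //;
    apply: spec_pick.
rewrite /peel_step /=; case: pick_min => [|u q] sp1;
  first exact: spec_case_leaf sp1 _.
apply: (@spec_case_node _ _ _ _ _ (enc_vert u) (enc_verts q) _ sp1);
  apply: spec_node.
  exact: spec_call2 (spec_rem _ _ leR').
by apply: spec_node => //; apply: spec_node => //;
  apply: spec_call3 (spec_nbrs _ _ leR').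
Qed.

End ListPrograms.

(** * Correctness of the programs for the core and the enumeration *)

Section CorePrograms.

Variables (G : graph) (S : nat).
Hypothesis leGS : nverts G <= S.
Notation vert := 'I_(nverts G).
Implicit Types (env : seq data) (x y : data) (u v : vert) (R I P Q K : seq vert)
  (U F : seq (vert * seq vert)).

Lemma mem_suffix (T : eqType) (s p q : seq T) z : s = p ++ z :: q -> z \in s.
Proof. by move=> ->; rewrite mem_cat mem_head orbT. Qed.

Lemma spec_longest U env : narrow S S U ->
  spec S TLongest (enc_family U :: env) (enc_verts (longest U)).
Proof.
move=> [leU nU].
apply: (spec_fold (r := fun U => enc_verts (longest U)) (e := @enc_entry G)) => //.
move=> r [u P] t E; have /nU /= leP := mem_suffix E.
apply: (@spec_case_node _ _ _ _ _ (enc_vert u) (enc_verts P)) => //=.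
apply: spec_if (_ : spec S _ _ (enc_bool (size P <= size (longest t)))) _ _.
- by apply: spec_call2 => //; apply: spec_leq; rewrite ?spine_verts.
- by move=> /negbTE ->.
- by move=> ->.
Qed.

Lemma spec_add x n e b env :
  spec S e env x -> spec S b env (enc_nat n) -> spine x <= S ->
  spec S (TFold e b (TNode TLeaf 1)) env (enc_nat (n + spine x)).
Proof.
move=> se sb leS; apply: (spec_iter (r := fun i => enc_nat (n + i))) => //.
  by rewrite addn0.
by move=> h i _; rewrite addnS; apply: spec_node.
Qed.

Lemma spec_cap s P env : s <= S -> size P <= S ->
  spec S TCap [:: enc_nat s, enc_verts P & env] (enc_nat (s * (size P).+2)).
Proof.
move=> leS leP; rewrite -{2}[s]spine_nat.
apply: (spec_iter (r := fun i => enc_nat (i * (size P).+2))) => //.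
  by rewrite spine_nat.
move=> h i _; rewrite mulSn addnC !addnS /=; apply: spec_node => //;
  apply: spec_node => //.
rewrite -[size P]spine_verts; apply: spec_add => //.
by rewrite spine_verts.
Qed.

Lemma spec_apart P Q env : size P <= S -> size Q <= S ->
  spec S TApart [:: enc_verts P, enc_verts Q & env] (enc_bool (apart P Q)).
Proof.
move=> leP leQ; apply: (spec_fold (r := fun P => enc_bool (apart P Q)) (e :=
  @enc_vert G)) => //.
move=> _ v t _; rewrite /=; apply: spec_if (_ : spec S _ _ (enc_bool (v \in Q)))
  _ _.
- exact: spec_call2 (spec_mem leGS _ _ leQ).
- by move=> ->.
- by move=> ->.
Qed.

Lemma spec_apart_all P F env : size P <= S -> narrow S S F ->
  spec S TApartAll [:: enc_verts P, enc_family F & env] (enc_bool (all (fun q =>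
    apart P q.2) F)).
Proof.
move=> leP [leF nF].
apply: (spec_fold (r := fun F => enc_bool (all (fun q => apart P q.2) F)) (e :=
  @enc_entry G)) => //.
move=> r [u Q] t E; have /nF /= leQ := mem_suffix E.
apply: (@spec_case_node _ _ _ _ _ (enc_vert u) (enc_verts Q)) => //=;
  apply: spec_and => //.
exact: spec_call2 (spec_apart _ leP leQ).
Qed.

Lemma narrow_greedy C U n m : narrow n m U -> narrow n m (greedy C U).
Proof.
move=> [len lem]; split; first exact: leq_trans (size_subseq (greedy_subseq C
  U)) len.
by move=> p /(mem_subseq (greedy_subseq C U)); apply: lem.
Qed.

Lemma narrow_suffix n m p U q : U = p ++ q -> narrow n m U -> narrow n m q.
Proof.
move=> -> [len lem]; split; first by apply: leq_trans len;
  rewrite size_cat leq_addl.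
by move=> r rq; apply: lem; rewrite mem_cat rq orbT.
Qed.

Lemma spec_greedy C U env : C <= S -> narrow S S U ->
  spec S TGreedy [:: enc_family U, enc_nat C & env] (enc_family (greedy C U)).
Proof.
move=> leC nU; have [leU _] := nU.
apply: (spec_fold (r := fun U => enc_family (greedy C U)) (e := @enc_entry G))
  => //.
move=> r [u P] t E; have [_ /(_ _ (mem_head _ _)) /= leP] := narrow_suffix E nU.
have nt : narrow S S t by apply: narrow_suffix nU; rewrite -cat_rcons in E;
  exact: E.
rewrite [greedy _ _]/=.
apply: spec_if (_ : spec S _ _ (enc_bool (C <= size (greedy C t)))) _ _.
- by apply: spec_call2 => //; apply: spec_leq; rewrite ?spine_nat ?spine_family.
- move=> /negbTE ->; apply: (@spec_case_node _ _ _ _ _ (enc_vert u) (enc_verts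
  P)) => //=.
  apply: spec_if.
  + exact: spec_call2 (spec_apart_all _ leP (narrow_greedy C nt)).
  + by move=> /negbTE ->.
  + by move=> ->.
- by move=> ->.
Qed.

Lemma spec_link u U env : narrow S S U ->
  spec S TLink [:: enc_vert u, enc_family U & env] (enc_family (link u U)).
Proof.
move=> [leU nU].
apply: (spec_fold (r := fun U => enc_family (link u U)) (e := @enc_entry G)) => //.
move=> r [v P] t E; have /nU /= leP := mem_suffix E.
apply: (@spec_case_node _ _ _ _ _ (enc_vert v) (enc_verts P)) => //=;
  rewrite /link /=.
apply: spec_if (_ : spec S _ _ (enc_bool (u \in P))) _ _.
- exact: spec_call2 (spec_mem leGS _ _ leP).
- by move=> /negbTE ->.
- move=> ->; apply: spec_node => //; apply: spec_node => //.
  exact: spec_call2 (spec_rem leGS _ _ leP).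
Qed.

Lemma spec_links F U Us env : narrow S S F -> narrow S S U ->
  spec S TLinks [:: enc_family F, enc_family U, enc_families Us & env]
    (enc_families (links F U ++ Us)).
Proof.
move=> [leF nF] nU.
apply: (spec_fold (r := fun F => enc_families (links F U ++ Us)) (e :=
  @enc_entry G)) => //.
move=> r [v P] t E; have /nF /= leP := mem_suffix E.
apply: (@spec_case_node _ _ _ _ _ (enc_vert v) (enc_verts P)) => //=.
rewrite /links /= -catA -/(links t U).
apply: (spec_fold (r := fun P => enc_families ([seq link u U | u <- P] ++ (links
  t U ++ Us))) (e := @enc_vert G)) => //.
by move=> _ x P' _; apply: spec_node => //; apply: spec_call2 (spec_link _ _ nU).
Qed.

Lemma spec_firsts F I env : size F <= S ->
  spec S TFirsts [:: enc_family F, enc_verts I & env] (enc_verts ([seq p.1 | p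
    <- F] ++ I)).
Proof.
move=> leF; apply: (spec_fold (r := fun F => enc_verts ([seq p.1 | p <- F] ++
  I)) (e := @enc_entry G)) => //.
Qed.

Definition enc_level (st : seq vert * seq (seq (vert * seq vert))) : data :=
  Node (enc_verts st.1) (enc_families st.2).

Lemma spec_level C st env : C <= S -> size st.2 <= S ->
  {in st.2, forall U, narrow S S U} ->
  spec S TLevel [:: enc_level st, enc_nat C & env] (enc_level (level C st)).
Proof.
case: st => out Us /= leC leUs nUs.
apply: (@spec_case_node _ _ _ _ _ (enc_verts out) (enc_families Us)) => //;
  apply: spec_node.
  apply: (spec_fold (r := fun Us => enc_verts (flatten [seq [seq p.1 | p <-
    greedy C U]
     | U <- Us] ++ out)) (e := @enc_family G)) => //.
  move=> r U t E; have nU := nUs _ (mem_suffix E); rewrite /= -catA.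
  apply: spec_call2 (spec_call2 _ _ (spec_greedy _ leC nU)) _ (spec_firsts _ _
    _) => //.
  by have [] := narrow_greedy C nU.
apply: (spec_fold (r := fun Us => enc_families (flatten [seq links (greedy C U)
  U | U <- Us]))
   (e := @enc_family G)) => //.
move=> r U t E; have nU := nUs _ (mem_suffix E).
apply: spec_call3 (spec_call2 _ _ (spec_greedy _ leC nU)) _ _ (spec_links _ _ _
  _) => //.
exact: narrow_greedy.
Qed.

(** Only the number of families per level has to be bounded: the output list is extended at its
    front and never folded over here. *)
Lemma spec_core C U P I env : C <= S -> size P < S ->
  narrow S S U ->
  (forall j, j <= (size P).+1 -> size (iter j (level C) (I, [:: U])).2 <= S) ->
  spec S TCore [:: enc_family U, enc_nat C, enc_verts P, enc_verts I & env]
    (enc_verts (core C (size P) U I)).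
Proof.
move=> leC leP nU leUs; pose st i := iter i (level C) (I, [:: U]).
apply: (@spec_case_node _ _ _ _ _ (enc_verts (st (size P).+1).1) (enc_families
  (st (size P).+1).2)) => //.
have Esp : spine (Node Leaf (enc_verts P)) = (size P).+1 by rewrite /= spine_verts.
rewrite -Esp; apply: (spec_iter (r := fun i => enc_level (st i))); rewrite ?Esp //.
move=> h i lti; rewrite (_ : st i.+1 = level C (st i)) //.
apply: spec_call2 (spec_level _ leC _ _) => //; first exact/leUs/ltnW.
by have [_ _ H] := iter_level_size C i I nU; exact: H.
Qed.

Lemma spec_pow2 x env : 2 ^ spine x <= S ->
  spec S TPow2 (x :: env) (enc_nat (2 ^ spine x)).
Proof.
move=> leS; apply: (spec_iter (r := fun i => enc_nat (2 ^ i))) => //.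
  by apply: leq_trans leS; apply: ltnW; apply: ltn_expl.
move=> h i lti; rewrite expnS mul2n -addnn -{3}[2 ^ i]spine_nat.
apply: spec_add => //.
by rewrite spine_nat; apply: leq_trans leS; rewrite leq_exp2l // ltnW.
Qed.

Lemma spec_nonadj v I env : size I <= S ->
  spec S TNonadj [:: enc_vert v, enc_verts I, enc_graph G & env] (enc_bool (all
    (fun w => ~~ adj v w) I)).
Proof.
move=> leI; apply: (spec_fold (r := fun I => enc_bool (all (fun w => ~~ adj v w)
  I)) (e := @enc_vert G)) => //.
move=> _ w t _; rewrite /=; apply: spec_if (_ : spec S _ _ (enc_bool (adj v w)))
  _ _.
- exact: spec_call3 (spec_adj leGS _ _ _).
- by move=> ->.
- by move=> ->.
Qed.

Lemma spec_expand l K (L : seq (seq vert)) env : l <= S -> size K <= S ->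
  size L <= S -> {in L, forall I, size I <= S} ->
  spec S TExpand [:: enc_states L, enc_verts K, enc_nat l, enc_graph G & env]
    (enc_states (expand l K L)).
Proof.
move=> leS leK leL leI.
apply: (spec_fold (r := fun L => enc_states (expand l K L)) (e := @enc_verts G))
  => //.
move=> r I t E; have {}leI := leI _ (mem_suffix E); apply: spec_node => //.
apply: (spec_fold (r := fun K' => enc_states (moves l K' I (expand l K t))) (e
  := @enc_vert G)) => //.
move=> _ v K' _ /=; set a := moves _ _ _ _.
apply: (spec_if (b := v \in I)); first exact: spec_call2 (spec_mem leGS _ _ leI).
  move=> /negbTE ->.
  apply: (spec_if (b := all (fun w => ~~ adj v w) I)).
  - exact: spec_call3 (spec_nonadj _ _ leI).
  - by move=> /negbTE ->.
  - by move=> ->.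
move=> ->; have rem e := spec_rem leGS v e leI.
apply: (spec_if (b := l <= size [seq w <- I | v != w])).
- apply: (@spec_call2 _ _ _ _ _ (enc_nat l) (enc_verts [seq w <- I | v != w]))
  => //.
    exact: spec_call2 (rem _).
  by apply: spec_leq; rewrite ?spine_nat ?spine_verts.
- by move=> /negbTE ->.
- by move=> ->; apply: spec_node => //; exact: spec_call2 (rem _).
Qed.

Lemma spec_large s (L : seq (seq vert)) env : s <= S -> size L <= S ->
  spec S TLarge [:: enc_states L, enc_nat s & env] (enc_bool (has (fun I => s <=
    size I) L)).
Proof.
move=> leS leL; apply: (spec_fold (r := fun L => enc_bool (has (fun I => s <=
  size I) L)) (e := @enc_verts G)) => //.
move=> _ I t _ /=; apply: (spec_if (b := s <= size I)).
- by apply: spec_call2 => //; apply: spec_leq; rewrite ?spine_nat ?spine_verts.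
- by move=> /negbTE ->.
- by move=> ->.
Qed.

Lemma spec_verts env : spec S TVerts (enc_graph G :: env) (enc_verts (rev (enum
  vert))).
Proof.
have sM : spine (enc_graph G) = nverts G by rewrite spine_seq size_map
  size_enum_ord.
pose r i := enc_seq [seq enc_nat j | j <- rev (iota 0 i)].
have <- : r (spine (enc_graph G)) = enc_verts (rev (enum vert)).
  rewrite /r /enc_verts sM -val_enum_ord -map_rev -map_comp.
  by congr enc_seq; apply: eq_map.
apply: spec_iter => //; first by rewrite sM.
move=> h i lti; have -> : r i.+1 = Node (enc_nat i) (r i) by rewrite /r -addn1
  iotaD rev_cat.
apply: spec_node => //.
have sr : spine (r i) = i by rewrite spine_seq size_map size_rev size_iota.
rewrite -[X in enc_nat X]add0n -{2}sr; apply: spec_add => //.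
by rewrite sr; apply: leq_trans leGS; rewrite -sM ltnW.
Qed.

Lemma spec_select R (J : {set vert}) env : size R <= S ->
  spec S TSelect [:: enc_verts R, enc_set J & env] (enc_verts [seq v <- R | v
    \in J]).
Proof.
move=> leR; apply: (spec_fold (r := fun R => enc_verts [seq v <- R | v \in J])
  (e := @enc_vert G)) => //.
move=> _ v t _ /=; apply: (spec_if (b := v \in J)).
- have <- : nth Leaf [seq enc_bool (v \in J) | v <- enum vert] v = enc_bool (v
  \in J).
    by rewrite (nth_map v) ?size_enum_ord // nth_ord_enum.
  apply: (@spec_call2 _ _ _ _ _ (enc_vert v) (enc_set J)) => //.
  by apply: spec_nth; apply: leq_trans (ltnW (ltn_ord v)) leGS.
- by move=> /negbTE ->.
- by move=> ->.
Qed.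

End CorePrograms.

(* [TSearch] and [TKernelize] also use the variables bound by the terms that they
   are plugged into. *)
Definition TSearch : tm :=
  TCall2 (TFold TPow2 (TNode 1 TLeaf)
            (TCall4 1 2 13 12 TExpand))
    7 TLarge.

Definition TKernelize : tm :=
  TCall2 (TCall2 2 4 (TCase TPeel TLeaf 1)) 0
    (TCall2 TLongest 0
      (TCall2 (TCall4 1 (TCall2 5 0 TCap) 0 3 TCore) 3
         TSearch)).

Definition TSolve : tm :=
  TCall2 TVerts 3
    (TCall2 (TCall2 0 4 TSelect) 1
      (TCase (TCall2 1 0 TLe) TKernelize TTrue)).

Definition TMain : tm :=
  TCase 0 TLeaf
    (TCase 1 TLeaf
      (TCase 1 TLeaf
        (TCase 1 TLeaf
          (TCall4 6 4 2 0 TSolve)))).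

(** The values of the preceding size bounds after [m.+1] levels: [width] for the families,
    [core_bound] for the core, [states_bound] for the enumeration with as many rounds as
    [2 ^ core_bound s m]. Their sum merely dominates each of them. *)
Definition cap (s m : nat) : nat := s * m.+2.
Definition width (s m : nat) : nat := (cap s m * m).+1 ^ m.+1.
Definition core_bound (s m : nat) : nat := s + m.+1 * width s m * cap s m.
Definition states_bound (s m : nat) : nat :=
  (core_bound s m).+1 ^ 2 ^ core_bound s m.
Definition param_bound (s m : nat) : nat :=
  s + cap s m + m.+1 + width s m + states_bound s m.

(** * Correctness of the whole program *)

Section Solve.

Variables (G : graph) (S l s : nat) (I : seq 'I_(nverts G)).
Notation vert := 'I_(nverts G).

Let R := rev (enum vert).
Let U := peel R.
Let m := size (longest U).

Hypotheses (leGS : nverts G <= S) (lelS : l <= S) (leS : param_bound s m <= S).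
Hypotheses (uI : uniq I) (vI : valid l [set x in I]).

Lemma uniq_verts : uniq R. Proof. by rewrite rev_uniq enum_uniq. Qed.

Lemma mem_verts v : v \in R. Proof. by rewrite mem_rev mem_enum. Qed.

Lemma size_verts : size R = nverts G. Proof. by rewrite size_rev size_enum_ord. Qed.

Lemma size_vert_list (J : seq vert) : uniq J -> size J <= S.
Proof.
by move=> /card_uniqP <-; apply: leq_trans leGS;
  rewrite -[X in _ <= X]card_ord max_card.
Qed.

Lemma narrow_peel : narrow (nverts G) m U.
Proof.
have [uni cov _ _] := peel_orientation uniq_verts mem_verts.
split; last by move=> p; apply: size_longest.
by rewrite -(size_map fst) -(card_uniqP uni) -[X in _ <= X]card_ord max_card.
Qed.

Lemma param_bounds : [/\ s <= S, cap s m <= S, m < S, width s m <= S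
  & states_bound s m <= S].
Proof. by move: leS; clear; rewrite /param_bound; split; lia. Qed.

Let K := core (cap s m) m U I.

Lemma size_core : size I < s -> size K <= core_bound s m.
Proof.
move=> ltI; have [le1 _ _] := iter_level_size (cap s m) m.+1 I narrow_peel.
by apply: leq_trans le1 _; rewrite leq_add2r ltnW.
Qed.

Lemma size_states_le j : size I < s -> j <= 2 ^ size K ->
  (size K).+1 ^ j <= S.
Proof.
move=> /size_core leK lej; have [_ _ _ _] := param_bounds; apply: leq_trans.
rewrite /states_bound; apply: (@leq_trans ((core_bound s m).+1 ^ j)).
  by case: j lej => // j _; rewrite leq_exp2r // ltnS.
by rewrite leq_pexp2l // (leq_trans lej) // leq_pexp2l.
Qed.

Lemma spec_kernelize e env : size I < s ->
  spec S TKernelize [:: enc_verts I, enc_nat s, enc_verts R, e, enc_graph G,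
    enc_nat l & env]
    (enc_bool (solve l s I R)).
Proof.
move=> ltI; have [lesS lecS ltmS lewS _] := param_bounds.
have -> : solve l s I R =
    has (fun J => s <= size J) (iter (2 ^ size K) (expand l K) [:: I]).
  by rewrite /solve leqNgt ltI.
have nU : narrow S S U.
  have [le1 le2] := narrow_peel; split; first exact: leq_trans leGS.
  by move=> p /le2 le3; apply: leq_trans le3 (ltnW ltmS).
have leRS : size R <= S by rewrite size_verts.
apply: (@spec_call2 _ _ _ _ _ (enc_family U) (enc_verts I)) => //.
  exact: spec_call2 (spec_peel leGS _ leRS).
apply: (@spec_call2 _ _ _ _ _ (enc_verts (longest U)) (enc_family U)) => //;
  first exact: spec_longest.
apply: (@spec_call2 _ _ _ _ _ (enc_verts K) (enc_verts I)) => //.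
  apply: (@spec_call4 _ _ _ _ _ _ _ (enc_family U) (enc_nat (cap s m))
    (enc_verts (longest U)) (enc_verts I)) => //.
    by apply: spec_call2 (spec_cap _ lesS (ltnW ltmS)).
  apply: spec_core => // j lej.
  have [_ le1 _] := iter_level_size (cap s m) j I narrow_peel.
  apply: leq_trans le1 (leq_trans _ lewS).
  by rewrite leq_pexp2l.
pose L j := iter j (expand l K) [:: I].
(* The counter of the rounds is itself a list that is folded over; its length is at most the bound
   on the number of states. *)
have leKS : 2 ^ size K <= S.
  apply: leq_trans (size_states_le ltI (leqnn _)).
  case: (size K) => // k; apply: (@leq_trans (2 ^ (2 ^ k.+1))).
    exact/ltnW/ltn_expl.
  by rewrite leq_exp2r ?expn_gt0.
have leL j : j <= 2 ^ size K -> size (L j) <= S.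
  move=> lej; exact: leq_trans (size_iter_expand _ _ _ _) (size_states_le ltI lej).
apply: (@spec_call2 _ _ _ _ _ (enc_states (L (2 ^ size K))) (enc_nat s)) => //;
  last first.
  by apply: spec_large => //; apply: leL.
have sK : spine (enc_nat (2 ^ spine (enc_verts K))) = 2 ^ size K.
  by rewrite spine_nat spine_verts.
rewrite -sK; apply: (spec_iter (r := fun j => enc_states (L j))) => //.
- by apply: spec_pow2; rewrite spine_verts.
- by rewrite sK.
move=> h j; rewrite sK => ltj; rewrite (_ : L j.+1 = expand l K (L j)) //.
apply: spec_call4 (spec_expand _ _ _ _ _ _) => //.
- exact: leq_trans (ltnW (ltn_expl _ _)) leKS.
- exact/leL/ltnW.
- by move=> J /(iter_expand_sound uI vI) [uJ _ _]; apply: size_vert_list.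
Qed.

End Solve.

Lemma spec_solve (G : graph) S l s (J : {set 'I_(nverts G)}) env :
  let R := rev (enum 'I_(nverts G)) in let I := [seq v <- R | v \in J] in
  let m := size (longest (peel R)) in
  nverts G <= S -> l <= S -> param_bound s m <= S ->
  valid l J -> spec S TSolve [:: enc_graph G, enc_nat l, enc_set J, enc_nat s & env]
    (enc_bool (solve l s I R)).
Proof.
move=> R I m leGS lelS leS vJ.
have uI : uniq I by rewrite filter_uniq // uniq_verts.
have vI : valid l [set x in I].
  suff -> : [set x in I] = J by [].
  by apply/setP => x; rewrite inE mem_filter mem_verts andbT.
apply: (@spec_call2 _ _ _ _ _ (enc_verts R) (enc_nat s)) => //;
  first exact: spec_verts.
apply: (@spec_call2 _ _ _ _ _ (enc_verts I) (enc_nat s)) => //.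
  by apply: spec_call2 (spec_select leGS _ _ _) => //; rewrite size_verts.
have les : s <= S by have [] := param_bounds leS.
apply: (spec_if (b := s <= size I)).
- by apply: spec_call2 => //; apply: spec_leq; rewrite ?spine_nat ?spine_verts.
- by rewrite -ltnNge => ltI; apply: spec_kernelize.
- by move=> leI; rewrite /solve leI.
Qed.

(** The first two summands account for vertex numbers, lists of distinct vertices and the threshold,
    the last one for all lists governed by the parameter. *)
Definition inst_bound (x : optISR_instance) : nat :=
  let G := inst_graph x in
  nverts G + inst_thr x +
  param_bound (inst_size x) (size (longest (peel (rev (enum 'I_(nverts G)))))).

Lemma spec_main (x : optISR_instance) :
  exists2 b : bool, spec (inst_bound x) TMain [:: enc_optISR x] (enc_bool b)
    & optISR x <-> b.
Proof.
case: x => G l J s iJ lJ; set x := OptISR _ _ _.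
have vJ : valid l J by apply/andP.
pose R := rev (enum 'I_(nverts G)); pose I := [seq v <- R | v \in J].
exists (solve l s I R).
  apply: (@spec_case_node _ _ _ _ _ (enc_graph G) (enc_seq [:: enc_nat l;
    enc_set J; enc_nat s])) => //.
  apply: (@spec_case_node _ _ _ _ _ (enc_nat l) (enc_seq [:: enc_set J;
    enc_nat s])) => //.
  apply: (@spec_case_node _ _ _ _ _ (enc_set J) (enc_seq [:: enc_nat s])) => //.
  apply: (@spec_case_node _ _ _ _ _ (enc_nat s) Leaf) => //.
  apply: (@spec_call4 _ _ _ _ _ _ _ (enc_graph G) (enc_nat l) (enc_set J)
    (enc_nat s)) => //.
  by apply: spec_solve => //; rewrite /inst_bound /=; lia.
have uI : uniq I by rewrite filter_uniq // uniq_verts.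
have EI : [set x in I] = J.
  by apply/setP => v; rewrite inE mem_filter mem_verts andbT.
have := @solveP G l s I R (uniq_verts G) (@mem_verts G) uI.
by rewrite EI => /(_ vJ); case=> H1 H2; split=> [/H2|/H1].
Qed.

(** * Tower-bounded running times *)

Definition tower (j k : nat) : nat := iter j (expn 2) k.

Lemma leq_tower i j k : i <= j -> tower i k <= tower j k.
Proof.
move/subnK <-; rewrite /tower; elim: (j - i) => //= n IH.
exact: leq_trans IH (ltnW (ltn_expl _ _)).
Qed.

Fixpoint TTower (j : nat) : tm :=
  if j is i.+1 then TCase (TNode (TTower i) TLeaf) TLeaf TPow2 else TVar 0.

Lemma spec_tower S j k : tower j k <= S ->
  spec S (TTower j) [:: enc_nat k] (enc_nat (tower j k)).
Proof.
elim: j => // j IH leS; apply: (@spec_case_node _ _ _ _ _ (enc_nat (tower j k))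
  Leaf).
  by apply: spec_node => //; apply: IH; apply: leq_trans leS; apply: leq_tower.
by have := @spec_pow2 S (enc_nat (tower j k)) [:: Leaf; enc_nat k];
  rewrite spine_nat; apply.
Qed.

(** [j] is fixed, so it can be unrolled into nested copies of [TPow2]. Computability asks for no
    time bound, so the loop bound may be the result itself. *)
Lemma computable_tower j : computable (tower j).
Proof.
exists (compiled (TTower j)) => k.
have [dk okk] := spec_tower (leqnn (tower j k)).
by have [n _ ev] := compiled_correct okk; exists n; rewrite -dk.
Qed.

Section TowerBounded.

Variables (X : Type) (kappa : X -> nat).
Implicit Types a b : X -> nat.

(* Towers are computable and absorb sums, products and powers: a time bound never
   has to be written as an explicit function of the parameter. *)
Definition tower_bounded b : Prop := exists j, forall x, b x <= tower j (kappa x).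

Lemma tower_bounded_le a b : (forall x, a x <= b x) ->
  tower_bounded b -> tower_bounded a.
Proof. by move=> le [j Hj]; exists j => x; apply: leq_trans (le x) (Hj x). Qed.

Lemma tower_bounded_const c : tower_bounded (fun=> c).
Proof.
exists c => x; apply: (@leq_trans (tower c 0)).
  by elim: c => //= c IH; apply: leq_ltn_trans IH (ltn_expl _ _).
by elim: c => //= c IH; rewrite leq_exp2l.
Qed.

Lemma tower_bounded_max a b : tower_bounded a -> tower_bounded b ->
  exists j, forall x, a x <= tower j (kappa x) /\ b x <= tower j (kappa x).
Proof.
move=> [i Hi] [j Hj]; exists (maxn i j) => x.
by split; [apply: leq_trans (Hi x) _ | apply: leq_trans (Hj x) _];
  apply: leq_tower; rewrite ?leq_maxl ?leq_maxr.
Qed.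

Lemma double_le_exp2 n : n + n <= 2 ^ n.
Proof. by elim: n => // -[|n] // IH; rewrite expnS; lia. Qed.

Lemma tower_bounded_add a b : tower_bounded a -> tower_bounded b ->
  tower_bounded (fun x => a x + b x).
Proof.
move=> ta tb; have [j Hj] := tower_bounded_max ta tb; exists j.+1 => x.
have [lea leb] := Hj x; exact: leq_trans (leq_add lea leb) (double_le_exp2 _).
Qed.

Lemma sqr_le_tower n : n * n <= 2 ^ 2 ^ n.
Proof.
apply: (@leq_trans (2 ^ n * 2 ^ n)); first by apply: leq_mul; apply/ltnW/ltn_expl.
by rewrite -expnD leq_exp2l // double_le_exp2.
Qed.

Lemma tower_bounded_mul a b : tower_bounded a -> tower_bounded b ->
  tower_bounded (fun x => a x * b x).
Proof.
move=> ta tb; have [j Hj] := tower_bounded_max ta tb; exists j.+2 => x.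
have [lea leb] := Hj x; exact: leq_trans (leq_mul lea leb) (sqr_le_tower _).
Qed.

(** As [a <= 2 ^ a], the power [a ^ b] is at most [2 ^ (a * b)]: one level above the product. *)
Lemma tower_bounded_exp a b : tower_bounded a -> tower_bounded b ->
  tower_bounded (fun x => a x ^ b x).
Proof.
move=> ta tb; have [j Hj] := tower_bounded_mul ta tb; exists j.+1 => x.
apply: (@leq_trans (2 ^ (a x * b x))); last by rewrite /tower iterS leq_exp2l.
rewrite expnM; case: (b x) => // n; rewrite leq_exp2r //; exact/ltnW/ltn_expl.
Qed.

Lemma tower_bounded_succ a : tower_bounded a -> tower_bounded (fun x => (a x).+1).
Proof.
move=> ta; apply: tower_bounded_le (tower_bounded_add ta (tower_bounded_const 1)).
by move=> x; rewrite addn1.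
Qed.

End TowerBounded.

(** * The running time in terms of parameter and input size *)

Lemma spine_dsize x : spine x < dsize x.
Proof. by elim: x => //= a _ b IH; rewrite ltnS (leq_trans IH) ?leq_addl. Qed.

Definition peel_degree (x : optISR_instance) : nat :=
  size (longest (peel (rev (enum 'I_(nverts (inst_graph x)))))).

Lemma peel_degree_le x : peel_degree x <= optISR_param x.
Proof.
apply: leq_trans (leq_addl _ _); apply: longest_le.
by have [] := peel_orientation (uniq_verts (inst_graph x)) (@mem_verts _).
Qed.

Lemma tower_bounded_param_bound :
  tower_bounded optISR_param (fun x => param_bound (inst_size x) (peel_degree x)).
Proof.
have ts : tower_bounded optISR_param inst_size.
  by exists 0 => x; apply: leq_addr.
have tm : tower_bounded optISR_param peel_degree.
  by exists 0; exact: peel_degree_le.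
rewrite /param_bound /states_bound /core_bound /width /cap.
by repeat first [assumption | exact: tower_bounded_const | apply: tower_bounded_succ
  | apply: tower_bounded_add | apply: tower_bounded_mul | apply: tower_bounded_exp].
Qed.

Theorem theorem6 :
  fixed_parameter_tractable enc_optISR optISR optISR_param.
Proof.
have [c Hc] := time_bound_poly TMain.
pose B x := param_bound (inst_size x) (peel_degree x).
(* The [4] is the overhead in [compiled_correct]; the [3] pays for the number of vertices, the
   threshold and the successor in the base of the power, each at most the input size. *)
have [j Hj] : tower_bounded optISR_param (fun x => c * (B x + 3) ^ c + 4).
  apply: tower_bounded_add (tower_bounded_const _ _).
  apply: tower_bounded_mul (tower_bounded_const _ _) _.
  apply: tower_bounded_exp (tower_bounded_const _ _).
  exact: tower_bounded_add tower_bounded_param_bound (tower_bounded_const _ _).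
exists (compiled TMain), (tower j), c; split; first exact: computable_tower.
move=> x; have [b [db okb] yb] := spec_main x; exists b.
have [t let_t ev] := compiled_correct okb; exists t; split=> //;
  first by rewrite -db.
set N := dsize _; have N0 : 0 < N by rewrite /N; case: enc_optISR.
(* The sum of an input part and a parameter part is bounded by a product, whose [c]-th power splits
   into the two factors required. *)
have leS : (inst_bound x).+1 <= (B x + 3) * N.
  have len : nverts (inst_graph x) < N.
    have := spine_dsize (enc_graph (inst_graph x)).
    by rewrite spine_seq size_map size_enum_ord /N /=; lia.
  have lel : inst_thr x < N.
    by have := spine_dsize (enc_nat (inst_thr x)); rewrite spine_nat /N /=; lia.
  have : B x <= B x * N by rewrite leq_pmulr.
  by rewrite /inst_bound -/(peel_degree x) -/(B x) mulnDl; lia.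
apply: leq_trans let_t _; apply: leq_trans (leq_mul (Hj x) (leqnn _)).
rewrite mulnDl; apply: leq_add; last by rewrite leq_pmulr // expn_gt0 N0.
apply: leq_trans (Hc _) _; rewrite -mulnA -expnMn leq_mul2l.
by case: c {Hc Hj} => // c; rewrite leq_exp2r ?leS ?orbT.
Qed.
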